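(* Let $\Delta$ be a positive integer and let $T$ be a subcubic subdivided caterpillar. There exists an integer $c_{T,\Delta}$ such that for every graph $G$ with maximum degree at most $\Delta$ that contains no induced subgraph isomorphic to a subdivision of $T$ and no induced subgraph isomorphic to the line graph of a subdivision of $T$, we have $\mathrm{tw}(G)\le c_{T,\Delta}$.
   Context: Graphs are finite and simple; $\mathrm{tw}$ denotes treewidth. A tree $T$ is a subdivided caterpillar if there is a path in $T$ containing every vertex of degree at least three in $T$; it is subcubic if every vertex has degree at most three. A subdivision of $T$ is obtained by replacing edges by paths (in particular $T$ itself is a subdivision of $T$). The line graph $L(F)$ of $F$ has vertex set $E(F)$, two vertices adjacent iff the edges share an end. *)

(* Defs.v *)
From mathcomp Require Import all_boot ssralg ssrnum ssrint.
From mathcomp Require Import boolp.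

Set Implicit Arguments.
Unset Strict Implicit.
Unset Printing Implicit Defensive.

Record sgraph := SGraph {
  vertex :> finType;
  adj : rel vertex;
  adj_sym : symmetric adj;
  adj_irrefl : irreflexive adj }.

Arguments adj {s} x y : rename.

Definition degree (G : sgraph) (v : G) : nat := #|[set u : G | adj v u]|.

Definition max_degree (G : sgraph) : nat := \max_(v : G) degree v.

Definition isomorphic (G H : sgraph) : Prop :=
  exists f : G -> H, bijective f /\ {mono f : x y / adj x y}.

Definition induced_adj (G : sgraph) (S : {set G}) : rel {x : G | x \in S} :=
  fun x y => adj (val x) (val y).

Fact induced_adj_sym (G : sgraph) (S : {set G}) : symmetric (@induced_adj G S).
Proof. by move=> x y; apply: adj_sym. Qed.

Fact induced_adj_irrefl (G : sgraph) (S : {set G}) :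
  irreflexive (@induced_adj G S).
Proof. by move=> x; apply: adj_irrefl. Qed.

Definition induced (G : sgraph) (S : {set G}) : sgraph :=
  SGraph (@induced_adj_sym G S) (@induced_adj_irrefl G S).

Definition contains_induced (G H : sgraph) : Prop :=
  exists S : {set G}, isomorphic (induced S) H.

Definition connected (G : sgraph) : Prop :=
  forall x y : G, connect (@adj G) x y.

(* [ucycle adj c] also holds for the empty sequence and for [:: x; y] with x, y
   adjacent, so genuine cycles are those of length at least 3. *)
Definition acyclic (G : sgraph) : Prop :=
  forall c : seq G, ucycle (@adj G) c -> size c < 3.

(* The null graph is not a tree. *)
Definition is_tree (G : sgraph) : Prop :=
  [/\ 0 < #|G|, connected G & acyclic G].

Definition subcubic (G : sgraph) : Prop := forall v : G, degree v <= 3.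

Definition subdivided_caterpillar (T : sgraph) : Prop :=
  is_tree T /\
  exists (x : T) (p : seq T),
    [/\ path (@adj T) x p, uniq (x :: p)
      & forall v : T, 3 <= degree v -> v \in x :: p].

(* [f] places the original vertices in [H], and [P x y] lists the internal
   vertices, from [f x] to [f y], of the path replacing the edge [x y]; it is
   empty when the edge is kept. *)
Definition subdivision_path (T H : sgraph) (f : T -> H) (P : T -> T -> seq H)
    (x y : T) : seq H := f x :: rcons (P x y) (f y).

Definition is_subdivision (T H : sgraph) : Prop :=
  exists (f : T -> H) (P : T -> T -> seq H),
    let Q := subdivision_path f P in
    [/\ injective f,
        forall x y, adj x y ->
          [/\ P y x = rev (P x y), sorted (@adj H) (Q x y) & uniq (Q x y)],
        (* the paths are internally disjoint from each other and from [f] *)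
        (forall x y z, adj x y -> f z \notin P x y) /\
        (forall x y x' y' v, adj x y -> adj x' y' ->
           v \in P x y -> v \in P x' y' -> [set x; y] = [set x'; y']),
        forall v : H, (exists x, v = f x) \/
          (exists x y, adj x y /\ v \in P x y)
      & forall u v : H, adj u v ->
          exists x y, adj x y /\ infix [:: u; v] (Q x y)].

Definition edges (G : sgraph) : {set {set G}} :=
  [set e | [exists u : G, exists v : G, adj u v && (e == [set u; v])]].

Definition line_adj (F : sgraph) : rel {e : {set F} | e \in edges F} :=
  fun e1 e2 => (e1 != e2) && (val e1 :&: val e2 != set0).

Fact line_adj_sym (F : sgraph) : symmetric (@line_adj F).
Proof. by move=> x y; rewrite /line_adj eq_sym setIC. Qed.

Fact line_adj_irrefl (F : sgraph) : irreflexive (@line_adj F).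
Proof. by move=> x; rewrite /line_adj eqxx. Qed.

Definition line_graph (F : sgraph) : sgraph :=
  SGraph (@line_adj_sym F) (@line_adj_irrefl F).

Definition is_tree_decomposition (G D : sgraph) (bag : D -> {set G}) : Prop :=
  [/\ is_tree D,
      forall v : G, exists t : D, v \in bag t,
      forall u v : G, adj u v -> exists t : D, (u \in bag t) && (v \in bag t)
    & forall v : G, connected (induced [set t : D | v \in bag t])].

Definition max_bag (G D : sgraph) (bag : D -> {set G}) : nat :=
  \max_(t : D) #|bag t|.

Definition has_decomposition_of_max_bag (G : sgraph) (k : nat) : Prop :=
  exists (D : sgraph) (bag : D -> {set G}),
    is_tree_decomposition bag /\ max_bag bag = k.

Fact unit_adj_sym : symmetric (fun _ _ : unit => false).
Proof. by []. Qed.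

Fact unit_adj_irrefl : irreflexive (fun _ : unit => xpred0 : pred unit).
Proof. by []. Qed.

Definition unit_graph : sgraph := SGraph unit_adj_sym unit_adj_irrefl.

Fact has_decomposition (G : sgraph) :
  exists k, `[< has_decomposition_of_max_bag G k >].
Proof.
exists #|G|; apply/asboolP.
exists unit_graph, (fun=> [set: G]); split; last first.
  by rewrite /max_bag big_const card_unit /= maxn0 cardsT.
split.
- split; first by rewrite card_unit.
    by move=> [] [].
  by move=> [|[] [|[] s]].
- by move=> v; exists tt; rewrite inE.
- by move=> u v _; exists tt; rewrite !inE.
- move=> v [[] h1] [[] h2].
  by rewrite (bool_irrelevance h1 h2) connect0.
Qed.

(* An integer, as the null graph has treewidth -1. *)
Definition treewidth (G : sgraph) : int :=
  ((ex_minn (has_decomposition G))%:Z - 1)%R.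

(* Main.v *)
(* Grow an induced path [v_0, ..., v_j] together with a connected set [C] that only
   [v_j] touches, replacing [C] at each step by a component of [C - N(v_j)].  If
   the neighbourhood [N(C)] always stays small, the sets [N(C) + (N(v_j) & C)] are
   the bags of a tree decomposition of bounded width.  Otherwise, at some moment
   many pairwise distant vertices [w] have neighbours both in [C] and on the path.
   Since each [w] has boundedly many neighbours on the path, one can pass to a
   subpath on which many of the [w] have neighbours in disjoint intervals.  If the
   interval of [w] is a single edge, [w] forms a triangle with it; otherwise the
   path, rerouted through [w] if the interval is not a single vertex, has a branch
   there.  The third leg at each branch or triangle runs from [w] into [C], and
   by distance the legs do not interact.  By pigeonhole, enough of these are of the
   same kind, which gives an induced subdivision of the caterpillar or the line
   graph of one. *)
Require Import Defs.
From mathcomp Require Import all_boot ssralg ssrnum ssrint.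
From mathcomp Require Import boolp zify.

Set Implicit Arguments.
Unset Strict Implicit.
Unset Printing Implicit Defensive.

(** The degree bound enters three times: it bounds the part of a bag inside $N(v_j)$, it lets a
    large $N(C)$ contain many pairwise distant vertices, and it bounds the number of neighbours of
    each $w$ on the path. The required distance exceeds $2l+3$, with $l$ the length of the longest
    leg of $T$: two legs of length $l$ joined by an edge put their origins within $2l+1$, and
    neighbours at consecutive path positions put them within 3. Legs can be drawn in $G$ with exact
    length, whereas the gaps between attachments on the path are not under control; so only spine
    edges of $T$ are ever subdivided. To make this explicit, $T$ is placed in a comb, each vertex
    having a spine position and a height. The subdivision keeps such coordinates, and all adjacency
    checks become arithmetic. Each of the $n$ spine vertices receives a branch or triangle of $G$
    with a full leg, whatever $T$ has there; the embedding takes only the initial part of the leg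
    that $T$ asks for. *)

(** * Tree decompositions from parent pointers *)

Definition par_adj (V : finType) (par : V -> V) : rel V :=
  fun x y => (x != y) && ((par x == y) || (par y == x)).

Fact par_adj_sym (V : finType) (par : V -> V) : symmetric (par_adj par).
Proof. by move=> x y; rewrite /par_adj eq_sym orbC. Qed.

Fact par_adj_irrefl (V : finType) (par : V -> V) : irreflexive (par_adj par).
Proof. by move=> x; rewrite /par_adj eqxx. Qed.

Definition par_graph (V : finType) (par : V -> V) : sgraph :=
  SGraph (@par_adj_sym V par) (@par_adj_irrefl V par).

(** [rk] certifies that following [par] ends at [r]. Any decreasing rank will do, so trees can be
    glued by shifting ranks. *)
Definition rooted (V : finType) (r : V) (par : V -> V) (rk : V -> nat) : Prop :=
  par r = r /\ forall x, x != r -> rk (par x) < rk x.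

Lemma rooted_connect (V : finType) (r : V) par rk (e : rel V) (x : V) :
  rooted r par rk -> (forall y, y != r -> e y (par y)) -> connect e x r.
Proof.
move=> [_ Hrk] He; have [k] := ubnP (rk x).
elim: k x => // k IH x Hx; have [->|xr] := eqVneq x r; first exact: connect0.
apply: (connect_trans (connect1 (He x xr))).
by apply: IH; apply: leq_trans (Hrk _ xr) _.
Qed.

(* In a cycle, a vertex of largest rank has its parent as both neighbours. *)
Lemma rooted_tree (V : finType) (r : V) par rk :
  rooted r par rk -> is_tree (par_graph par).
Proof.
move=> Hr; have [Hpr Hrk] := Hr; split.
- by apply/card_gt0P; exists r.
- have toroot x : connect (@adj (par_graph par)) x r.
    apply: (rooted_connect _ Hr) => y yr; apply/andP; split; last by rewrite eqxx.
    by apply/eqP => E; have := Hrk _ yr; rewrite -E ltnn.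
  move=> x y; apply: connect_trans (toroot x) _.
  by rewrite sym_connect_sym // => u v; apply: adj_sym.
- move=> c Hc; rewrite ltnNge; apply/negP => Hs.
  have [x0 x0c] : exists x, x \in c.
    by case: (c) Hs => // a l _; exists a; rewrite mem_head.
  case: (arg_maxnP rk x0c) => x /= xc xmax.
  have [i c' Ec] := rot_to xc.
  have up y : y \in c -> par_adj par x y -> y = par x.
    move=> yc /andP [nxy /orP [/eqP //|/eqP pyx]].
    have [yr|yr] := eqVneq y r; first by move: nxy; rewrite -pyx yr Hpr eqxx.
    by have := Hrk _ yr; rewrite pyx ltnNge; move/negP; case; apply: xmax.
  have memc z : z \in x :: c' -> z \in c by rewrite -Ec mem_rot.
  have Hsz : size c = (size c').+1 by rewrite -(size_rot i) Ec.
  move: Hc; rewrite /ucycle -(rot_cycle i) -(rot_uniq i) Ec => /andP [].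
  case: c' Hsz memc {Ec} => [|y c'] Hsz memc.
    by rewrite Hsz in Hs.
  case/lastP: c' Hsz memc => [|c' z] Hsz memc; first by rewrite Hsz in Hs.
  rewrite /= !rcons_path last_rcons => /andP [xy /andP [_ zx]] /andP [_ /andP [yn _]].
  have ey : y = par x by apply: up xy; apply: memc; rewrite !inE eqxx orbT.
  have ez : z = par x.
    apply: up; first by apply: memc; rewrite !inE mem_rcons inE eqxx !orbT.
    by rewrite par_adj_sym.
  by move: yn; rewrite ey ez mem_rcons inE eqxx.
Qed.

(* Decomposition of the edges meeting [Z], where [X] contains the neighbours of
   [Z]; the last condition, with parent pointers, says that the nodes whose bag
   contains a given vertex span a subtree. *)
Definition partial_dec (G : sgraph) (b : nat) (Z X : {set G}) : Prop :=
  exists (V : finType) (r : V) (par : V -> V) (rk : V -> nat) (bag : V -> {set G}),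
  [/\ rooted r par rk, X \subset bag r
    & forall t, (bag t \subset Z :|: X) && (#|bag t| <= b)] /\
  [/\ forall u, u \in Z -> exists t, u \in bag t,
      forall u v, u \in Z -> adj u v -> exists t, (u \in bag t) && (v \in bag t)
    & forall v t t', v \in bag t -> v \in bag t' ->
        (t == r) || (v \notin bag (par t)) ->
        (t' == r) || (v \notin bag (par t')) -> t = t'].

Lemma partial_dec_set0 (G : sgraph) b (X : {set G}) :
  #|X| <= b -> partial_dec b set0 X.
Proof.
move=> Xb; exists unit, tt, id, (fun=> 0), (fun=> X); split; split => //.
- by move=> t; rewrite set0U subxx.
- by move=> u; rewrite inE.
- by move=> u v; rewrite inE.
- by move=> v [] [].
Qed.

(** The second tree is hung below the root of the first. A vertex occurring in both lies in [X2],
    hence in both root bags, so its nodes still form one subtree, with top node in the first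
    tree. *)
Lemma partial_dec_union (G : sgraph) b (Z1 X1 Z2 X2 : {set G}) :
  partial_dec b Z1 X1 -> partial_dec b Z2 X2 ->
  X2 \subset X1 -> [disjoint Z2 & Z1 :|: X1] -> partial_dec b (Z1 :|: Z2) X1.
Proof.
move=> [V1 [r1 [p1 [k1 [B1 [[[pr1 kr1] XB1 b1] [c1 e1 t1]]]]]]].
move=> [V2 [r2 [p2 [k2 [B2 [[[pr2 kr2] XB2 b2] [c2 e2 t2]]]]]]] X21 dis.
pose par (t : V1 + V2) := match t with
  | inl t => inl (p1 t)
  | inr t => if t == r2 then inl r1 else inr (p2 t) end.
pose rk (t : V1 + V2) := match t with inl t => k1 t | inr t => (k1 r1 + k2 t).+1 end.
pose bag (t : V1 + V2) := match t with inl t => B1 t | inr t => B2 t end.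
have both v s t : v \in B1 s -> v \in B2 t -> (v \in B1 r1) /\ (v \in B2 r2).
  move=> v1 v2; have /andP [/subsetP /(_ _ v1) {}v1 _] := b1 s.
  have /andP [/subsetP /(_ _ v2) {}v2 _] := b2 t.
  have vX2 : v \in X2.
    move: v2; rewrite inE => /orP [] // vZ2.
    by have := disjointFr dis vZ2; rewrite v1.
  by rewrite (subsetP XB2) // (subsetP XB1) // (subsetP X21).
exists (V1 + V2)%type, (inl r1), par, rk, bag; split; split => //.
- split=> [|[t|t]] /=; first by rewrite pr1.
    by move=> nt; apply: kr1; apply: contra nt => /eqP ->.
  move=> _; case: ifP => [_|/negbT /kr2 /=]; first by rewrite ltnS leq_addr.
  by rewrite ltnS ltn_add2l.
- case=> t /=.
    have /andP [s1 ->] := b1 t; rewrite andbT; apply: subset_trans s1 _.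
    by apply: setSU; apply: subsetUl.
  have /andP [s1 ->] := b2 t; rewrite andbT; apply: subset_trans s1 _.
  by apply: setUSS => //; apply: subsetUr.
- move=> u; rewrite inE => /orP [/c1|/c2] [t ut]; first by exists (inl t).
  by exists (inr t).
- move=> u v; rewrite inE => /orP [/e1|/e2] H /H [t ut]; first by exists (inl t).
  by exists (inr t).
- move=> v; suff sym s t : v \in bag (inl s) -> v \in bag (inr t) ->
      ~ ((inr t == inl r1 :> V1 + V2) || (v \notin bag (par (inr t)))).
    case=> t [] t' vt vt' H H' //.
    + by congr inl; apply: t1 vt vt' H H'.
    + by case: (sym _ _ vt vt').
    + by case: (sym _ _ vt' vt).
    congr inr; apply: t2 vt vt' _ _.
      by move: H => /=; case: ifP => //.
    by move: H' => /=; case: ifP => //.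
  move=> vs vt; have [v1 v2] := both _ _ _ vs vt.
  rewrite /=; case: eqVneq => [_|tr]; first by rewrite v1.
  move=> vp; case/eqP: tr; apply: (t2 v) => //.
    by rewrite vp orbT.
  by rewrite eqxx.
Qed.

(** The decomposition does not change. The root bag contains [X :|: Y], so an edge at [Y] is covered
    there, unless it goes to [Z], where it was covered already. *)
Lemma partial_dec_absorb (G : sgraph) b (Z X Y : {set G}) :
  (forall u v, u \in Y -> adj u v -> v \in Z :|: (X :|: Y)) ->
  partial_dec b Z (X :|: Y) -> partial_dec b (Z :|: Y) X.
Proof.
move=> HY [V [r [par [rk [bag [[Hr XB bb] [cov edg top]]]]]]].
have inr x : x \in X :|: Y -> x \in bag r by apply: (subsetP XB).
exists V, r, par, rk, bag; split; split => //.
- by apply: subset_trans XB; apply: subsetUl.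
- by move=> t; rewrite -setUA (setUC Y).
- move=> u; rewrite inE => /orP [/cov //|uY].
  by exists r; apply: inr; rewrite inE uY orbT.
- move=> u v; rewrite inE => /orP [|uY] ; first exact: edg.
  move=> uv; have := HY _ _ uY uv; rewrite inE => /orP [vZ|vX].
    by have [|t] := edg v u vZ; [rewrite adj_sym|exists t; rewrite andbC].
  by exists r; rewrite !inr // inE uY orbT.
Qed.

(** Two nodes whose bags contain [v] are joined by climbing from each for as long as [v] stays in
    the bag: by the last condition of [partial_dec] both climbs end at the same node. *)
Lemma partial_dec_treewidth (G : sgraph) b :
  partial_dec b [set: G] set0 -> (treewidth G <= b%:Z)%R.
Proof.
move=> [V [r [par [rk [bag [[Hr XB bb] [cov edg top]]]]]]].
have Hdec : is_tree_decomposition (D := par_graph par) bag.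
  split.
  - exact: rooted_tree Hr.
  - by move=> v; apply: cov; rewrite inE.
  - by move=> u v; apply: edg; rewrite inE.
  - move=> v.
    pose H := induced (G := par_graph par) [set t : par_graph par | v \in bag t].
    have up (x : H) : exists y : H,
        connect (@adj H) x y /\ ((val y == r) || (v \notin bag (par (val y)))).
      have [k] := ubnP (rk (val x)); elim: k x => // k IH x Hx.
      case: (boolP ((val x == r) || (v \notin bag (par (val x))))) => Hc.
        by exists x.
      move: Hc; rewrite negb_or negbK => /andP [xr vp].
      have yP : par (val x) \in [set t : par_graph par | v \in bag t] by rewrite inE.
      pose y : H := exist (fun t => t \in [set t : par_graph par | v \in bag t]) _ yP.
      have [|z [xz Hz]] := IH y; first by apply: leq_trans (Hr.2 _ xr) _.
      exists z; split => //; apply: connect_trans xz; apply: connect1.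
      rewrite /= /induced_adj /= /par_adj eqxx orTb andbT.
      by apply/eqP => E; have := Hr.2 _ xr; rewrite -E ltnn.
    move=> x y; have [x' [xx' Hx']] := up x; have [y' [yy' Hy']] := up y.
    have E : x' = y'.
      apply: val_inj; apply: (top v) => //.
        by have := valP x'; rewrite inE.
      by have := valP y'; rewrite inE.
    apply: connect_trans xx' _; rewrite E.
    rewrite sym_connect_sym // => a c; exact: adj_sym.
rewrite /treewidth; case: ex_minnP => m _ Hm.
have Hle : m <= max_bag (D := par_graph par) bag.
  by apply: Hm; apply/asboolP; exists (par_graph par), bag.
have Hb : max_bag (D := par_graph par) bag <= b.
  by apply/bigmax_leqP => t _; have /andP [] := bb t.
lia.
Qed.

(** * Growing an induced path *)

Definition nbr (G : sgraph) (v : G) : {set G} := [set u | adj v u].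

Definition bnd (G : sgraph) (Z : {set G}) : {set G} :=
  [set u | (u \notin Z) && [exists v in Z, adj v u]].

Definition rel_in (G : sgraph) (Z : {set G}) : rel G :=
  fun x y => [&& x \in Z, y \in Z & adj x y].

Definition connected_in (G : sgraph) (Z : {set G}) : Prop :=
  {in Z &, forall x y, connect (rel_in Z) x y}.

Definition comp (G : sgraph) (Z : {set G}) (z : G) : {set G} :=
  [set y in Z | connect (rel_in Z) z y].

Lemma rel_in_sym (G : sgraph) (Z : {set G}) : connect_sym (rel_in Z).
Proof.
by apply: sym_connect_sym => x y; rewrite /rel_in adj_sym andbCA.
Qed.

Lemma mem_bnd (G : sgraph) (Z : {set G}) u v :
  v \in Z -> adj v u -> u \notin Z -> u \in bnd Z.
Proof.
by move=> vZ vu uZ; rewrite inE uZ; apply/existsP; exists v; rewrite vZ.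
Qed.

Lemma bndP (G : sgraph) (Z : {set G}) u :
  reflect (u \notin Z /\ exists2 v, v \in Z & adj v u) (u \in bnd Z).
Proof.
rewrite inE; apply: (iffP andP) => [[H /existsP [v /andP [vZ vu]]]|[H [v vZ vu]]].
  by split=> //; exists v.
by split=> //; apply/existsP; exists v; rewrite vZ.
Qed.

Lemma mem_comp (G : sgraph) (Z : {set G}) z : z \in Z -> z \in comp Z z.
Proof. by move=> zZ; rewrite inE zZ connect0. Qed.

Lemma comp_sub (G : sgraph) (Z : {set G}) z : comp Z z \subset Z.
Proof. by apply/subsetP => x; rewrite inE => /andP []. Qed.

Lemma comp_closed (G : sgraph) (Z : {set G}) z x y :
  x \in comp Z z -> y \in Z -> adj x y -> y \in comp Z z.
Proof.
rewrite !inE => /andP [xZ zx] yZ xy; rewrite yZ (connect_trans zx) //.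
by apply: connect1; rewrite /rel_in xZ yZ.
Qed.

Lemma connect_invariant (T : finType) (e : rel T) (P : pred T) x y :
  (forall a b, P a -> e a b -> P b) -> P x -> connect e x y -> P y.
Proof.
move=> H + /connectP [p]; elim: p x => [|z p IH] x Px /=; first by move=> _ ->.
by move=> /andP [xz pz] Ey; apply: (IH z) => //; apply: H xz.
Qed.

Lemma comp_connected (G : sgraph) (Z : {set G}) z :
  z \in Z -> connected_in (comp Z z).
Proof.
move=> zZ.
have toz y : y \in comp Z z -> connect (rel_in (comp Z z)) z y.
  move=> yc; suff : (y \in comp Z z) && connect (rel_in (comp Z z)) z y.
    by case/andP.
  apply: (@connect_invariant _ (rel_in Z)
    (fun y => (y \in comp Z z) && connect (rel_in (comp Z z)) z y) z).
  - move=> a b /andP [ac za] /and3P [_ bZ ab].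
    have bc := comp_closed ac bZ ab.
    by rewrite bc (connect_trans za) //; apply: connect1; rewrite /rel_in ac bc.
  - by rewrite mem_comp // connect0.
  - by move: yc; rewrite inE => /andP [].
move=> x y xc yc; apply: connect_trans (toz y yc).
by rewrite rel_in_sym; apply: toz.
Qed.

Lemma bnd_comp (G : sgraph) (Z X : {set G}) z :
  bnd Z \subset X -> bnd (comp Z z) \subset X.
Proof.
move=> ZX; apply/subsetP => u /bndP [uc [v vc vu]].
apply: (subsetP ZX); apply: (mem_bnd (subsetP (comp_sub Z z) v vc) vu).
by apply: contra uc => uZ; apply: (comp_closed vc uZ vu).
Qed.

(** If the component of [x] in [C :\: Y] had no neighbour in [Y], it would be closed under adjacency
    in [C], and so contain [y]. This is how a path finds its next vertex. *)
Lemma connected_exit (G : sgraph) (C Y : {set G}) x y :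
  connected_in C -> Y \subset C -> x \in C -> y \in Y ->
  x \notin Y -> exists2 u, u \in bnd (comp (C :\: Y) x) & u \in Y.
Proof.
move=> Cc YC xC yY xY.
have yC : y \in C by apply: (subsetP YC).
apply: contrapT => H.
suff /(subsetP (comp_sub _ _)) : y \in comp (C :\: Y) x by rewrite inE yY.
apply: (@connect_invariant _ (rel_in C) (mem (comp (C :\: Y) x)) x _ _ _ (Cc x y xC yC)).
  move=> a b aK /and3P [aC bC ab].
  apply: (comp_closed aK _ ab); rewrite inE bC andbT; apply/negP => bY.
  apply: H; exists b => //; apply: (mem_bnd aK ab _).
  by apply/negP => /(subsetP (comp_sub _ _)); rewrite inE bY.
by apply: mem_comp; rewrite inE xY.
Qed.

(** Starting from a single bag [X], the components of [Z] are added one at a time. The union [D] of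
    those already added is closed under adjacency in [Z], so a component that starts outside [D] is
    disjoint from it. *)
Lemma partial_dec_components (G : sgraph) b (Z X : {set G}) :
  bnd Z \subset X -> [disjoint Z & X] -> #|X| <= b ->
  (forall z, z \in Z -> partial_dec b (comp Z z) (bnd (comp Z z))) ->
  partial_dec b Z X.
Proof.
move=> ZX dis Xb H.
suff ind n (D : {set G}) : #|Z :\: D| <= n -> D \subset Z ->
    (forall x y, x \in D -> y \in Z -> adj x y -> y \in D) ->
    partial_dec b D X -> partial_dec b Z X.
  apply: (ind _ set0 (leqnn _)); first exact: sub0set.
    by move=> x y; rewrite inE.
  exact: partial_dec_set0.
elim: n D => [|n IH] D.
  rewrite leqn0 cards_eq0 setD_eq0 => ZD DZ _.
  by rewrite (_ : D = Z) //; apply/eqP; rewrite eqEsubset DZ.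
move=> Hn DZ Dcl HD.
have [ZD|] := boolP (Z \subset D).
  by apply: IH HD => //; move: ZD; rewrite -setD_eq0 => /eqP ->; rewrite cards0.
case/subsetPn => z zZ zD.
have disD : [disjoint comp Z z & D].
  rewrite disjoint_subset; apply/subsetP => y; rewrite !inE => /andP [yZ zy].
  apply: contra zD => yD; rewrite rel_in_sym in zy.
  apply: (@connect_invariant _ (rel_in Z) (mem D) _ _ _ _ zy) => //.
  by move=> a c aD /and3P [_ cZ ac]; apply: Dcl ac.
apply: (IH (D :|: comp Z z)).
- rewrite -ltnS; apply: leq_trans Hn; apply: proper_card.
  apply/properP; split; first by apply: setDS; apply: subsetUl.
  by exists z; rewrite !inE ?zZ ?zD ?connect0 ?orbT.
- by rewrite subUset DZ comp_sub.
- move=> x y; rewrite inE => /orP [xD|xc] yZ xy; rewrite inE.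
    by rewrite (Dcl x).
  by rewrite (comp_closed xc) ?orbT.
- apply: partial_dec_union HD (H z zZ) (bnd_comp _ ZX) _.
  rewrite disjoint_subset; apply/subsetP => y yc; rewrite !inE negb_or.
  have yZ := subsetP (comp_sub _ _) _ yc.
  by rewrite (disjointFr disD yc) (disjointFr dis yZ).
Qed.

(** The root bag is [bnd C :|: Y]. It contains the boundary of every component of [C :\: Y], and
    once these are attached, [partial_dec_absorb] moves [Y] to the decomposed side. *)
Lemma partial_dec_step (G : sgraph) b (C Y : {set G}) :
  connected_in C -> Y \subset C -> #|bnd C :|: Y| <= b ->
  (forall z, z \in C :\: Y -> let D := comp (C :\: Y) z in
      partial_dec b D (bnd D)) ->
  partial_dec b C (bnd C).
Proof.
move=> Cc YC Hb H.
have bC u v : u \in C -> adj u v -> (v \in C) || (v \in bnd C).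
  by move=> uC uv; case: (boolP (v \in C)) => //= vC; apply: (mem_bnd uC uv vC).
have E : C = C :\: Y :|: Y by rewrite -{1}(setID C Y) (setIidPr YC) setUC.
rewrite [C in partial_dec _ C _]E; apply: partial_dec_absorb.
  move=> u v uY uv; have /orP [vC|vC] := bC u v (subsetP YC u uY) uv.
    by rewrite !inE vC; case: (v \in Y); rewrite ?orbT.
  by rewrite !in_setU vC !orbT.
apply: partial_dec_components => //.
  apply/subsetP => u /bndP [uZ [v vZ vu]]; rewrite in_setU.
  move: vZ; rewrite inE => /andP [_ vC].
  have /orP [uC|->//] := bC v u vC vu.
  by move: uZ; rewrite inE uC andbT negbK => ->; rewrite orbT.
rewrite disjoint_subset; apply/subsetP => u; rewrite !inE => /andP [uY uC].
by rewrite uC (negbTE uY).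
Qed.

Fixpoint induced_path (G : sgraph) (p : seq G) : bool :=
  match p with
  | [::] => true
  | v :: p' =>
    [&& v \notin p', induced_path p' &
      match p' with
      | [::] => true
      | u :: p'' => adj v u && all (fun x => ~~ adj v x) p''
      end]
  end.

(* The induced path is listed from its last vertex, the only one with
   neighbours in the connected set [C]; all other neighbours of [C] are
   neighbours of earlier path vertices. *)
Definition path_state (G : sgraph) (v : G) (p : seq G) (C : {set G}) : Prop :=
  [/\ induced_path (v :: p), connected_in C, v \in bnd C,
      forall u, u \in p -> (u \notin C) && (u \notin bnd C)
    & forall w, w \in bnd C -> w != v -> exists2 u, u \in p & adj u w].

(** The new end [y] is a neighbour of [v] in [C] that touches the new component. Older path vertices
    lie outside [bnd C], so they miss [y]; and [v] loses contact with the component because all of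
    [nbr v] was removed. A boundary vertex of the component was either in [bnd C] already or is a
    neighbour of [v]. *)
Lemma path_state_next (G : sgraph) (v : G) p (C : {set G}) z :
  path_state v p C -> z \in C :\: nbr v ->
  exists y, path_state y (v :: p) (comp (C :\: nbr v) z).
Proof.
move=> [ip Cc vb pC bp] zZ; set Z := C :\: nbr v; set D := comp Z z.
have /bndP [vC [y0 y0C y0v]] := vb.
have ZE : Z = C :\: (nbr v :&: C) by rewrite setDIr setDv setU0.
have [zC zv] : z \in C /\ ~~ adj v z by move: zZ; rewrite !inE => /andP [-> ->].
have [y yb yY] : exists2 u, u \in bnd (comp (C :\: (nbr v :&: C)) z) &
    u \in nbr v :&: C.
  apply: (connected_exit (y := y0) Cc); first by apply: subsetIr.
  - done.
  - by rewrite !inE adj_sym y0v.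
  - by rewrite !inE zC andbT.
rewrite -ZE -/D in yb.
have [yC vy] : y \in C /\ adj v y by move: yY; rewrite !inE => /andP [-> ->].
have DC x : x \in D -> x \in C /\ ~~ adj v x.
  by move=> /(subsetP (comp_sub _ _)); rewrite !inE => /andP [-> ->].
have pny u : u \in p -> u != y /\ ~~ adj y u.
  move=> up; have /andP [uC ub] := pC u up; split.
    by apply: contra uC => /eqP ->.
  by apply: contra ub => yu; apply: (mem_bnd yC yu uC).
have nvy : y != v by apply: contra vC => /eqP <-.
exists y; split.
- rewrite /= !inE negb_or nvy; apply/and3P; split.
  + by apply/negP => /pny []; rewrite eqxx.
  + exact: ip.
  + by rewrite adj_sym vy; apply/allP => u /pny [].
- exact: comp_connected.
- exact: yb.
- move=> u; rewrite inE => /orP [/eqP ->|up].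
    apply/andP; split; first by apply/negP => /DC []; rewrite (negbTE vC).
    by apply/negP => /bndP [_ [x /DC [_]]]; rewrite adj_sym => /negbTE ->.
  have /andP [uC ub] := pC u up.
  apply/andP; split; first by apply/negP => /DC [] /(negP uC).
  apply/negP => /bndP [_ [x /DC [xC _] xu]].
  by move/negP: ub; apply; apply: (mem_bnd xC xu uC).
- move=> w /bndP [wD [x xD xw]] nwy; have [xC vx] := DC x xD.
  have [wC|wC] := boolP (w \in C).
    exists v; rewrite ?mem_head //; apply: contraNT wD => vw.
    by apply: (comp_closed xD _ xw); rewrite !inE wC vw.
  have wb : w \in bnd C by apply: (mem_bnd xC xw wC).
  have nwv : w != v.
    by apply/eqP => E; move: vx; rewrite adj_sym -E xw.
  have [u up uw] := bp w wb nwv.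
  by exists u => //; rewrite inE up orbT.
Qed.

Lemma card_nbr (G : sgraph) (v : G) : #|nbr v| <= max_degree G.
Proof. by rewrite /max_degree (bigmax_sup v). Qed.

(** Induction on the size of [C]: a bag consists of [bnd C] and the neighbours of [v] in [C], hence
    the summand [max_degree G]. Each remaining component carries a longer path state and is smaller,
    since [C] contains a neighbour of [v]. *)
Lemma treewidth_path_state (G : sgraph) (s : nat) : 0 < s ->
  (forall v p (C : {set G}), path_state v p C -> #|bnd C| <= s) ->
  (treewidth G <= (s + max_degree G)%N%:Z)%R.
Proof.
move=> s0 Hs; set b := s + max_degree G; apply: partial_dec_treewidth.
have rec n (v : G) p (C : {set G}) : #|C| <= n -> path_state v p C -> partial_dec b C (bnd C).
  elim: n v p C => [|n IH] v p C Hn St.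
    have [_ _ /bndP [_ [y yC _]] _ _] := St.
    by move: Hn; rewrite leqn0 cards_eq0 => /eqP E; rewrite E inE in yC.
  have [_ Cc /bndP [vC [y yC yv]] _ _] := St.
  apply: (partial_dec_step (Y := nbr v :&: C)) => //; first exact: subsetIr.
    apply: leq_trans (leq_card_setU _ _) _; apply: leq_add; first exact: Hs St.
    by apply: leq_trans (card_nbr v); apply: subset_leq_card; apply: subsetIl.
  rewrite setDIr setDv setU0 => z zZ /=.
  have [y' St'] := path_state_next St zZ; apply: IH St'.
  rewrite -ltnS; apply: leq_trans Hn; apply: proper_card.
  apply/properP; split.
    by apply: subset_trans (comp_sub _ _) _; apply: subsetDl.
  exists y => //; apply/negP => /(subsetP (comp_sub _ _)).
  by rewrite !inE adj_sym yv.
apply: partial_dec_components => //.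
- by apply/subsetP => u /bndP [] ; rewrite inE.
- by rewrite -setI_eq0 setI0.
- by rewrite cards0.
move=> z _; set K := comp _ z.
have Kb : bnd K = set0.
  by apply/eqP; rewrite -subset0; apply: bnd_comp; apply/subsetP => u /bndP []; rewrite inE.
have zK : z \in K by apply: mem_comp; rewrite inE.
have Kc : connected_in K by apply: comp_connected; rewrite inE.
(* The start of the recursion: one vertex [z] is removed from each component [K] of [G]. Every
   component of the rest has boundary [[set z]], which is a path state with the one-vertex path
   [z]. *)
apply: (partial_dec_step (Y := [set z])) => //.
- by rewrite sub1set.
- by rewrite Kb set0U cards1 /b addn_gt0 s0.
move=> x xZ; have /setD1P [xz xK] := xZ.
set D := comp _ x.
have Db u : u \in bnd D -> u = z.
  move=> /bndP [uD [y yD yu]].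
  have /setD1P [yz yK] := subsetP (comp_sub _ _) _ yD.
  apply/eqP; apply: contraNT uD => uz; apply: (comp_closed yD _ yu).
  rewrite !inE uz; apply: contraT => uK.
  have : u \in bnd K by apply: (mem_bnd yK yu _); rewrite inE inE.
  by rewrite Kb inE.
apply: (rec #|D| z [::]) => //; split => //.
- by apply: comp_connected.
- have [|||u ub uz] := connected_exit (Y := [set z]) (y := z) Kc _ xK.
  + by rewrite sub1set.
  + by rewrite inE.
  + by rewrite inE.
  by rewrite -(Db u ub).
- by move=> w /Db ->; rewrite eqxx.
Qed.

(** * Balls, legs and disjoint spans *)

Definition ball (G : sgraph) (r : nat) (v : G) : {set G} :=
  iter r (fun S => S :|: \bigcup_(x in S) nbr x) [set v].

Lemma ballSP (G : sgraph) r (v u : G) :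
  reflect (u \in ball r v \/ exists2 x, x \in ball r v & adj x u) (u \in ball r.+1 v).
Proof.
rewrite [ball _ _]/= in_setU; apply: (iffP orP).
  by case=> [->|/bigcupP [x xb]]; [left|rewrite inE; right; exists x].
case=> [->|[x xb xu]]; [by left|right; apply/bigcupP; exists x => //].
by rewrite inE.
Qed.

Lemma ball_mono (G : sgraph) r s (v : G) : r <= s -> ball r v \subset ball s v.
Proof.
move/subnK <-; elim: (s - r) => // n IH; rewrite addSn.
by apply: subset_trans IH _; apply/subsetP => u ub; apply/ballSP; left.
Qed.

Lemma ball_refl (G : sgraph) r (v : G) : v \in ball r v.
Proof. by apply: (subsetP (ball_mono v (leq0n r))); rewrite inE. Qed.

Lemma ball_trans (G : sgraph) r s (v u w : G) :
  u \in ball r v -> w \in ball s u -> w \in ball (r + s) v.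
Proof.
move=> ur; elim: s w => [|s IH] w.
  by rewrite addn0 inE => /eqP ->.
rewrite addnS => /ballSP [/IH wb|[x /IH xb xw]]; apply/ballSP; first by left.
by right; exists x.
Qed.

Lemma ball_adj (G : sgraph) (v u : G) : adj v u -> u \in ball 1 v.
Proof. by move=> vu; apply/ballSP; right; exists v => //; rewrite inE. Qed.

Lemma ball_sym (G : sgraph) r (v u : G) : (u \in ball r v) = (v \in ball r u).
Proof.
suff H (x y : G) : x \in ball r y -> y \in ball r x by apply/idP/idP; apply: H.
elim: r x y => [|r IH] x y; first by rewrite !inE eq_sym.
case/ballSP => [/IH ub|[z /IH zb zx]]; first by apply/ballSP; left.
by apply: (ball_trans (r := 1) _ zb); apply: ball_adj; rewrite adj_sym.
Qed.

Lemma card_ball (G : sgraph) d r (v : G) :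
  max_degree G <= d -> #|ball r v| <= d.+1 ^ r.
Proof.
move=> Gd; elim: r => [|r IH]; first by rewrite cards1.
rewrite [ball _ _]/= expnS mulSn; apply: leq_trans (leq_card_setU _ _) _.
apply: leq_add => //; apply: leq_trans (_ : #|ball r v| * d <= _); last first.
  by rewrite mulnC leq_mul2l IH orbT.
rewrite -sum_nat_const; set B := ball r v.
apply: (@leq_trans (\sum_(x in B) #|nbr x|)); last first.
  by apply: leq_sum => x _; apply: leq_trans (card_nbr x) Gd.
apply: (big_ind2 (fun (S : {set G}) n => #|S| <= n)) => //; first by rewrite cards0.
move=> S n S' n' Sn Sn'; apply: leq_trans (leq_card_setU _ _) _; exact: leq_add.
Qed.

(** Greedy: each chosen vertex costs its ball, which has at most [d.+1 ^ R] vertices. *)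
Lemma far_subset (G : sgraph) d R n (W : {set G}) :
  max_degree G <= d -> n * d.+1 ^ R <= #|W| ->
  exists W' : {set G}, [/\ W' \subset W, n <= #|W'|
    & {in W' &, forall u v, u != v -> u \notin ball R v}].
Proof.
move=> Gd; elim: n W => [|n IH] W Hn.
  by exists set0; split; rewrite ?sub0set ?cards0 // => u v; rewrite inE.
have [w wW] : exists w, w \in W.
  by apply/card_gt0P; apply: leq_trans Hn; rewrite muln_gt0 expn_gt0.
have [|W' [W'W Hn' far]] := IH (W :\: ball R w).
  rewrite cardsD leq_subRL; last by apply: leq_trans Hn; rewrite mulSn;
    apply: leq_trans (leq_addr _ _); apply: leq_trans (card_ball R w Gd);
    apply: subset_leq_card; apply: subsetIr.
  apply: leq_trans Hn; rewrite mulSn leq_add2r.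
  by apply: leq_trans (card_ball R w Gd); apply: subset_leq_card; apply: subsetIr.
have fw u : u \in W' -> u \notin ball R w.
  by move/(subsetP W'W); rewrite inE => /andP [].
exists (w |: W'); split.
- by rewrite subUset sub1set wW; apply: subset_trans W'W _; apply: subsetDl.
- rewrite cardsU1 (_ : w \notin W') ?add1n //.
  by apply/negP => /fw; rewrite ball_refl.
move=> u v; rewrite !inE => /orP [/eqP ->|uW] /orP [/eqP ->|vW] nuv.
- by rewrite eqxx in nuv.
- by rewrite ball_sym fw.
- exact: fw.
- exact: far.
Qed.

(* Vertices taken from consecutive distance levels around [w] in [C + w] form an
   induced path. *)
Lemma leg_exists (G : sgraph) l (C : {set G}) (w z : G) :
  connected_in C -> w \in bnd C -> z \in C -> z \notin ball l w ->
  exists c : nat -> G,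
  [/\ c 0 = w, forall j, 0 < j <= l -> c j \in C, forall j, j <= l -> c j \in ball j w,
      forall i j, i <= l -> j <= l -> c i = c j -> i = j
    & forall i j, i <= l -> j <= l ->
        adj (c i) (c j) = (i.+1 == j) || (j.+1 == i)].
Proof.
move=> Cc /bndP [wC [y yC yw]] zC zb.
(* [E r] is the ball around [w] with distance measured inside $C + w$; levels of distance in $G$
   could lead the leg out of [C]. *)
pose E r : {set G} := iter r (fun S => S :|: (\bigcup_(x in S) nbr x :&: C)) [set w].
have ES r u : u \in E r -> u \in E r.+1 by move=> uE; rewrite [E _]/= inE uE.
have EA r x u : x \in E r -> adj x u -> u \in C -> u \in E r.+1.
  move=> xE xu uC; rewrite [E _]/= !inE uC andbT; apply/orP; right.
  by apply/bigcupP; exists x; rewrite ?inE.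
have EP r u : u \in E r.+1 -> u \in E r \/ (u \in C /\ exists2 x, x \in E r & adj x u).
  rewrite [E _]/= !inE => /orP [->|]; first by left.
  move=> /andP [/bigcupP [x xE xu] uC].
  by right; split=> //; exists x => //; rewrite inE in xu.
have Eb r u : u \in E r -> u \in ball r w.
  elim: r u => // r IH u /EP [/IH ub|[_ [x /IH xb xu]]]; apply/ballSP; first by left.
  by right; exists x.
have EC r u : u \in E r -> (u == w) || (u \in C).
  by elim: r u => [u|r IH u /EP [/IH //|[-> _]]]; rewrite ?inE ?orbT // => ->.
have exz : exists r, z \in E r.
  pose P := [pred u | `[< exists r, u \in E r >]].
  have PE a b : P a -> rel_in C a b -> P b.
    move=> /asboolP [r ar] /and3P [_ bC ab]; apply/asboolP.
    by exists r.+1; apply: EA ab bC.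
  have Py : P y.
    by apply/asboolP; exists 1; apply: (EA 0 w); rewrite ?inE // adj_sym.
  by have /asboolP := connect_invariant PE Py (Cc y z yC zC).
have chain m u : u \in E m -> (forall r, r < m -> u \notin E r) ->
    exists c : nat -> G, forall j, j <= m ->
      [/\ c j \in E j, forall r, r < j -> c j \notin E r
        & j < m -> adj (c j) (c j.+1)] /\ c m = u.
  elim: m u => [|m IH] u uE uN; first by exists (fun=> u) => j; rewrite leqn0 => /eqP ->.
  have [uEm|[uC [x xE xu]]] := EP _ _ uE.
    by case/negP: (uN m (ltnSn m)).
  have [|c Hc] := IH x xE.
    by move=> r rm; apply: contra (uN r.+1 rm) => xr; apply: EA xu uC.
  exists (fun j => if j <= m then c j else u) => j; rewrite ltnn.
  rewrite leq_eqVlt => /predU1P [->|]; first by rewrite !ltnn; split.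
  rewrite ltnS => jm; rewrite jm; have [[cj cr ca] cm] := Hc j jm; split=> //; split=> // _.
  case: ltnP => [/ca //|mj]; have <- : m = j by apply/eqP; rewrite eqn_leq mj.
  by rewrite cm.
have [m zm mmin] := ex_minnP exz.
(* Distance inside $C + w$ is at least distance in $G$, so [z] has level above [l]; the first [l]
   steps of a shortest chain to [z] form the leg. *)
have lm : l < m.
  rewrite ltnNge; apply: contra zb => ml.
  by apply: (subsetP (ball_mono _ ml)); apply: Eb.
have [|c Hc] := chain m z zm.
  by move=> r rm; apply/negP => /mmin; rewrite leqNgt rm.
have cE j : j <= l -> c j \in E j by move=> jl; have [[]] := Hc j (leq_trans jl (ltnW lm)).
have cN j r : j <= l -> r < j -> c j \notin E r.
  by move=> jl; have [[_ + _] _] := Hc j (leq_trans jl (ltnW lm)); apply.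
have cA j : j < l -> adj (c j) (c j.+1).
  by move=> jl; have [[_ _ +] _] := Hc j (leq_trans (ltnW jl) (ltnW lm)); apply; apply: ltn_trans lm.
have cC j : 0 < j <= l -> c j \in C.
  move=> /andP [j0 jl]; have /EC /orP [/eqP E0|//] := cE j jl.
  by have := cN j 0 jl j0; rewrite E0 inE eqxx.
have cadj i j : i < j -> j <= l -> adj (c i) (c j) = (i.+1 == j).
  move=> ij jl; apply/idP/eqP => [cij|Ej]; last by rewrite -Ej; apply: cA; rewrite Ej.
  apply/eqP; rewrite eqn_leq ij leqNgt; apply/negP => ij'.
  have /negP := cN j i.+1 jl ij'; apply; apply: EA cij _; first by apply: cE; lia.
  by apply: cC; lia.
exists c; split => //.
- by have := cE 0 (leq0n l); rewrite inE => /eqP.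
- by move=> j jl; apply/Eb/cE.
- have inj i j : i < j -> j <= l -> c i <> c j.
    move=> ij jl cij; have := cN j i jl ij; rewrite -cij cE //; lia.
  move=> i j il jl cij; case: (ltngtP i j) => // ij.
    by case: (inj i j ij jl).
  by case: (inj j i ij il).
- move=> i j il jl; case: (ltngtP i j) => [ij|ij|->].
  + by rewrite cadj // (_ : j.+1 == i = false) ?orbF //; lia.
  + by rewrite adj_sym cadj // (_ : i.+1 == j = false) //; lia.
  by rewrite adj_irrefl; apply/esym/negP; lia.
Qed.

(** Greedy by right ends: every interval not lying entirely after the one with smallest right end
    [g w] contains the point [g w]. Either [M] intervals do so, or fewer than [M] are discarded and
    the choice is repeated. *)
Lemma interval_chain (T : finType) (f g : T -> nat) K M (W : {set T}) :
  K * M <= #|W| -> {in W, forall w, f w <= g w} ->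
  (exists ws : seq T, [/\ size ws = K, {subset ws <= W}
     & pairwise (fun u v => g u < f v) ws]) \/
  (exists p, M <= #|[set w in W | f w <= p <= g w]|).
Proof.
elim: K W => [|K IH] W Hn fg; first by left; exists [::].
have [M0|M0] := posnP M; first by right; exists 0; rewrite M0.
have /card_gt0P [w1 w1W] : 0 < #|W| by apply: leq_trans Hn; rewrite mulSn; lia.
case: (arg_minnP g w1W) => w wW wmin.
set A := [set u in W | f u <= g w <= g u].
have [MA|AM] := leqP M #|A|; first by right; exists (g w).
have AE u : (u \in W :\: A) = (u \in W) && (g w < f u).
  rewrite !inE; case uW : (u \in W) => //=.
  by rewrite (wmin u uW) !andbT -ltnNge.
have AW : A \subset W by apply/subsetP => u; rewrite inE => /andP [].
have [|||] := IH (W :\: A).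
- by rewrite cardsD (setIidPr AW); move: Hn; rewrite mulSn; lia.
- by move=> u; rewrite inE => /andP [_ uW]; apply: fg.
- move=> [ws [sz sub pw]]; left; exists (w :: ws); split => /=.
  + by rewrite sz.
  + by move=> u; rewrite inE => /predU1P [->|/sub] //; rewrite AE => /andP [].
  rewrite pw andbT; apply/allP => u /sub; rewrite AE => /andP [] //.
move=> [p pM]; right; exists p; apply: leq_trans pM _; apply: subset_leq_card.
by apply/subsetP => u; rewrite !inE => /andP [/andP [_ ->] ->].
Qed.

Lemma sorted_bounds (s : seq nat) x :
  sorted ltn s -> x \in s -> head 0 s <= x <= last 0 s.
Proof.
case: s => // y s /= Hp; have : sorted leq (y :: s).
  by apply: sub_path Hp => a b /ltnW.
rewrite /= => ps; rewrite inE => xs; apply/andP; split.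
  have /allP := order_path_min leq_trans ps; move=> H.
  by case/predU1P: xs => [->|/H].
case/predU1P: xs => [->|/path.splitPr Hs].
  have /allP H := order_path_min leq_trans ps.
  by have := mem_last y s; rewrite inE => /predU1P [->|/H].
case: Hs ps => s1 s2; rewrite cat_path last_cat /= => /and3P [_ _ ps2].
have /allP H := order_path_min leq_trans ps2.
by have := mem_last x s2; rewrite inE => /predU1P [->|/H].
Qed.

(** The product is the one of [interval_chain]; the successor pays for the one set that may contain
    the cutting point itself. At [d = 0] one element suffices, as a nonempty set of size 0 is
    absurd. *)
Fixpoint disjoint_bound (d K : nat) : nat :=
  if d is d'.+1 then K * (disjoint_bound d' K).+1 else 1.

(* If no [K] of the spans of the sets [nb w] are disjoint, many of them share an
   interior point, and cutting there makes each of these [nb w] smaller. *)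
Lemma disjoint_spans (T : finType) d K (W : {set T}) (nb : T -> seq nat) :
  disjoint_bound d K <= #|W| ->
  {in W, forall w, [/\ nb w != [::], sorted ltn (nb w) & size (nb w) <= d]} ->
  {in W &, forall u v x, x \in nb u -> x \in nb v -> u = v} ->
  exists (a : pred nat) (ws : seq T),
    [/\ forall x y, a y -> x <= y -> a x, size ws = K, {subset ws <= W},
        {in ws, forall w, [seq x <- nb w | a x] != [::]}
      & pairwise (fun u v => last 0 [seq x <- nb u | a x] <
                             head 0 [seq x <- nb v | a x]) ws].
Proof.
elim: d W nb => [|d IH] W nb /= Hn Hnb dis.
  have /card_gt0P [w /Hnb [nw _]] := Hn.
  by rewrite leqn0 size_eq0 (negbTE nw).
have fg w : w \in W -> head 0 (nb w) <= last 0 (nb w).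
  move=> /Hnb [nw sw _]; case: (nb w) nw sw => // x s _ sw.
  by have := sorted_bounds sw (mem_head x s); case/andP => _.
have [[ws [sz sub pw]]|[p pM]] := interval_chain Hn fg.
  exists predT, ws; split => //.
    by move=> w /sub /Hnb [nw _ _]; rewrite filter_predT.
  by apply: sub_pairwise pw => u v; rewrite !filter_predT.
set W1 := [set w in W | _] in pM.
(* The sets [nb w] are disjoint, so at most one contains [p]. For all others [p] lies strictly
   inside the span: cutting keeps the first element and loses the last. *)
pose W2 := [set w in W1 | p \notin nb w].
have W12 : #|W1 :\: W2| <= 1.
  apply/card_le1P => u; rewrite !inE => /andP [+ /andP [uW upq]].
  rewrite uW upq /= negbK => pu v; rewrite !inE.
  apply/idP/eqP => [/andP [+ /andP [vW vpq]]|->].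
    by rewrite vW vpq /= negbK => pv; apply: (dis v u vW uW p).
  by rewrite uW upq pu.
have W2W1 : W2 \subset W1 by apply/subsetP => u; rewrite inE => /andP [].
pose nb' w := [seq x <- nb w | x < p].
have W2P w : w \in W2 -> [/\ w \in W, head 0 (nb w) < p & p < last 0 (nb w)].
  rewrite !inE => /andP [/andP [wW /andP [fp pg]] pn]; split=> //.
    rewrite ltn_neqAle fp andbT; apply: contra pn => /eqP <-.
    by have [+ _ _] := Hnb w wW; case: (nb w) => // x s _; rewrite mem_head.
  rewrite ltn_neqAle pg andbT; apply: contra pn => /eqP ->.
  by have [+ _ _] := Hnb w wW; case: (nb w) => // x s _; rewrite /= mem_last.
have [||| a [ws [ad sz sub ne pw]]] := IH W2 nb'.
- move: W12; rewrite cardsD (setIidPr W2W1); have := subset_leq_card W2W1; lia.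
- move=> w /W2P [wW fp pg]; have [nw sw szw] := Hnb w wW; split.
  + have hw : head 0 (nb w) \in nb' w.
      rewrite mem_filter fp /=; by case: (nb w) nw => // x s; rewrite mem_head.
    by apply/eqP => E; rewrite E in hw.
  + exact: (sorted_filter ltn_trans).
  rewrite -ltnS; apply: leq_trans szw; rewrite size_filter -(count_predC (fun x => x < p) (nb w)).
  rewrite -addn1 leq_add2l -has_count; apply/hasP; exists (last 0 (nb w)).
    by case: (nb w) nw => // x s _; rewrite /= mem_last.
  by rewrite /= -leqNgt ltnW.
- move=> u v /W2P [uW _ _] /W2P [vW _ _] x; rewrite !mem_filter => /andP [_ xu] /andP [_ xv].
  exact: (dis u v uW vW x).
have E w : [seq x <- nb' w | a x] = [seq x <- nb w | a x && (x < p)].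
  by rewrite -filter_predI.
exists (fun x => a x && (x < p)), ws; split => //.
- by move=> x y /andP [ay yp] xy; rewrite (ad x y) //=; apply: leq_ltn_trans yp.
- by move=> w /sub /W2P [].
- by move=> w /ne; rewrite E.
- by apply: sub_pairwise pw => u v; rewrite !E.
Qed.

(** * Coordinates on a subdivided caterpillar *)

(** The infinite comb: [(i, j)] is the vertex at height [j] on the leg at spine position [i], and
    the spine is the row of height 0. *)
Definition comb_adj (c1 c2 : nat * nat) : bool :=
  [&& c1.2 == 0, c2.2 == 0 & (c1.1.+1 == c2.1) || (c2.1.+1 == c1.1)]
  || (c1.1 == c2.1) && ((c1.2.+1 == c2.2) || (c2.2.+1 == c1.2)).

Lemma comb_adj_sym : symmetric comb_adj.
Proof. by move=> [i j] [i' j']; rewrite /comb_adj /=; lia. Qed.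

Lemma comb_adj_irrefl : irreflexive comb_adj.
Proof. by move=> [i j]; rewrite /comb_adj /=; lia. Qed.

Lemma no_long_cycle (G : sgraph) (x : G) p :
  acyclic G -> path (@adj G) x p -> uniq (x :: p) -> 1 < size p ->
  ~~ adj (last x p) x.
Proof.
move=> ac px up sp; apply/negP => lx.
have : ucycle (@adj G) (x :: p) by rewrite /ucycle up andbT /= rcons_path px.
by move/ac; rewrite /= ltnS ltnNge sp.
Qed.

(** A chord would close a cycle with the part of the path between its ends. *)
Lemma tree_path_induced (G : sgraph) (x0 : G) (s : seq G) i j :
  acyclic G -> sorted (@adj G) s -> uniq s -> i < j < size s ->
  adj (nth x0 s i) (nth x0 s j) = (i.+1 == j).
Proof.
move=> ac so us /andP [ij js]; apply/idP/eqP => [aij|Ej]; last first.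
  by rewrite -Ej; apply/(sortedP x0 so); rewrite Ej.
apply/eqP; rewrite eqn_leq ij leqNgt; apply/negP => ij2.
have Ed := drop_nth x0 (ltn_trans ij js).
set p := take (j - i) (drop i.+1 s).
have sp : size p = j - i by rewrite size_takel // size_drop; lia.
have Ec : take (j - i).+1 (drop i s) = nth x0 s i :: p by rewrite Ed.
have := @no_long_cycle G (nth x0 s i) p ac.
have -> : path (@adj G) (nth x0 s i) p.
  by have : sorted (@adj G) (nth x0 s i :: p) by rewrite -Ec take_sorted // drop_sorted.
have -> : uniq (nth x0 s i :: p) by rewrite -Ec take_uniq // drop_uniq.
have -> : last (nth x0 s i) p = nth x0 s j.
  rewrite (last_nth x0) sp -Ec nth_take // nth_drop; congr nth; lia.
by rewrite adj_sym aij sp => H; apply: (negP (H _ _ _)) => //; lia.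
Qed.

Lemma degree_uniq (G : sgraph) (y : G) (l : seq G) :
  uniq l -> {in l, forall z, adj y z} -> size l <= degree y.
Proof.
move=> ul H; rewrite /degree -(card_uniqP ul); apply: subset_leq_card.
by apply/subsetP => z zl; rewrite inE H.
Qed.

(** A longest path through all vertices of degree at least three is taken; an outside neighbour of
    one of its ends would extend it. So a spine vertex that carries a leg has two spine neighbours,
    which leaves room for one leg only in a subcubic tree. *)
Lemma maximal_spine (T : sgraph) :
  subdivided_caterpillar T ->
  exists s : seq T, [/\ 0 < size s, sorted (@adj T) s, uniq s,
    forall v, 3 <= degree v -> v \in s
    & forall u y, u \notin s -> adj u y -> y \in s -> 0 < index y s < (size s).-1].
Proof.
move=> [_ [x [p [px up Hp]]]].
pose Q s := [/\ sorted (@adj T) s, uniq s & forall v, 3 <= degree v -> v \in s].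
have exP : exists k, `[< exists s, Q s /\ size s = k >].
  by exists (size (x :: p)); apply/asboolP; exists (x :: p).
have bdP k : `[< exists s, Q s /\ size s = k >] -> k <= #|T|.
  move=> /asboolP [s [[_ us _] <-]]; rewrite -(card_uniqP us); exact: max_card.
case: (ex_maxnP exP bdP) => k /asboolP [s [[so us Hs] Ek]] kmax.
have big s' : Q s' -> size s' <= size s.
  by move=> Q'; rewrite Ek; apply: kmax; apply/asboolP; exists s'.
have s0 : 0 < size s by apply: leq_trans (big (x :: p) _).
exists s; split => // u y us' uy ys.
case: s {Ek kmax} so us Hs big s0 us' ys => // h t so us Hs big _ uN ys.
have hu : ~~ adj u h.
  apply/negP => uh; have := big (u :: h :: t); rewrite /= ltnn => H.
  suff : Q (u :: h :: t) by move/H.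
  split; rewrite /= ?uh ?uN //.
  by move=> v /Hs vs; rewrite in_cons vs orbT.
have lu : ~~ adj u (last h t).
  apply/negP => ul; have := big (rcons (h :: t) u); rewrite size_rcons ltnn => H.
  suff : Q (rcons (h :: t) u) by move/H.
  split.
  - by rewrite /= rcons_path (so : path _ _ _) adj_sym.
  - by rewrite rcons_uniq uN.
  by move=> v /Hs vs; rewrite mem_rcons inE vs orbT.
have yi : index y (h :: t) < (size t).+1 by rewrite -[(size t).+1]/(size (h :: t)) index_mem.
have Ey := nth_index h ys.
apply/andP; split.
  rewrite lt0n; apply: contra hu => /eqP E; by rewrite E /= in Ey; rewrite Ey.
rewrite -[(size _).-1]/(size t) ltn_neqAle -ltnS yi andbT.
apply: contra lu => /eqP E; rewrite E in Ey.
by rewrite (last_nth h) Ey.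
Qed.

(** [T] is an induced subgraph of the comb that contains exactly the spine positions below [n] and
    meets each leg in an initial segment. *)
Definition comb_coords (T : sgraph) (n : nat) (a d : T -> nat) : Prop :=
  [/\ forall x, a x < n,
      forall x y, a x = a y -> d x = d y -> x = y,
      forall x y, adj x y = comb_adj (a x, d x) (a y, d y),
      forall i, i < n -> exists2 x, a x = i & d x = 0
    & forall x j, d x = j.+1 -> exists2 y, a y = a x & d y = j].

(** A path in [S] between two neighbours of [x] would close a cycle through [x]. *)
Lemma tree_unique_attachment (T : sgraph) (S : {set T}) (x y y' : T) :
  acyclic T -> connected_in S -> x \notin S -> y \in S -> y' \in S ->
  adj x y -> adj x y' -> y' = y.
Proof.
move=> ac Sc xS yS y'S xy xy'; apply/eqP; apply: contraT => nyy'.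
have /connectP [p pp lp] := Sc y y' yS y'S.
case: (shortenP pp) lp => p' pp' up' _ lp.
have pS : {subset p' <= S}.
  elim: p' y {pp yS xy nyy' up' lp} pp' => //= z p' IH y /andP [/and3P [_ zS _] /IH H] u.
  by rewrite inE => /predU1P [->|/H].
have pa : path (@adj T) y p'.
  by apply: sub_path pp' => u v /and3P [].
case: p' up' lp pS pa {pp'} => [|z p'] up' lp pS pa.
  by rewrite lp eqxx in nyy'.
have := @no_long_cycle T x (y :: z :: p') ac; rewrite [last _ _]/= -[last _ _]lp.
rewrite adj_sym xy' => H; apply: H => //; first by rewrite /= xy; move: pa => /=.
rewrite cons_uniq up' andbT; apply: contra xS.
by rewrite inE => /predU1P [->|/pS].
Qed.

(** Coordinates are extended from the spine one vertex at a time: a new vertex [x] has a unique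
    neighbour [y] in the connected set [S] reached so far, and is placed just above it. *)
Lemma caterpillar_coords (T : sgraph) :
  subcubic T -> subdivided_caterpillar T ->
  exists n (a d : T -> nat), 0 < n /\ comb_coords n a d.
Proof.
move=> sub cat; have [[_ Tc ac] _] := cat.
have [s [s0 so us Hs send]] := maximal_spine cat.
pose n := size s.
have [x0 _] : exists x, x \in s by case: (s) s0 => // h t _; exists h; rewrite mem_head.
pose St (S : {set T}) (a d : T -> nat) :=
  [/\ {subset s <= S}, connected_in S & {in s, forall x, a x = index x s /\ d x = 0}] /\
  [/\ {in S, forall x, a x < n},
      {in S &, forall x y, a x = a y -> d x = d y -> x = y},
      {in S &, forall x y, adj x y = comb_adj (a x, d x) (a y, d y)}
    & {in S, forall x j, d x = j.+1 -> exists y, [/\ y \in S, a y = a x & d y = j]}].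
suff [a [d [[sS Sc sa] [aS inj adjS dn]]]] : exists a d, St setT a d.
  exists n, a, d; split => //; split.
  - by move=> x; apply: aS.
  - by move=> x y; apply: inj.
  - by move=> x y; apply: adjS.
  - move=> i ni; have [aE dE] := sa _ (mem_nth x0 ni); exists (nth x0 s i) => //.
    by rewrite aE index_uniq.
  - by move=> x j /(dn x) [|y [_ ay dy]]; [rewrite inE|exists y].
have base : St [set x in s] (fun x => index x s) (fun=> 0).
  split; split => //.
  - by move=> x; rewrite inE.
  - have [h [t Es]] : exists h t, s = h :: t by case: (s) s0 => // h t _; exists h, t.
    have toh k : k < n -> connect (rel_in [set x in s]) h (nth x0 s k).
      elim: k => [|k IH] kn; first by rewrite Es connect0.
      apply: connect_trans (IH (ltnW kn)) _; apply: connect1.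
      rewrite /rel_in !inE !mem_nth ?(ltnW kn) //=.
      by rewrite (tree_path_induced x0 ac so us) ?eqxx // ltnSn.
    move=> x y; rewrite !inE => xs ys.
    rewrite -(nth_index x0 xs) -(nth_index x0 ys).
    apply: (@connect_trans _ _ h); last by apply: toh; rewrite index_mem.
    by rewrite rel_in_sym; apply: toh; rewrite index_mem.
  - by move=> x; rewrite inE /n index_mem.
  - move=> x y; rewrite !inE => xs ys E _.
    by rewrite -(nth_index x0 xs) -(nth_index x0 ys) E.
  - move=> x y; rewrite !inE => xs ys.
    rewrite -{1}(nth_index x0 xs) -{1}(nth_index x0 ys) /comb_adj /=.
    have ix : index x s < size s by rewrite index_mem.
    have iy : index y s < size s by rewrite index_mem.
    rewrite andbF orbF; case: (ltngtP (index x s) (index y s)) => ixy.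
    + by rewrite (tree_path_induced x0 ac so us) ?ixy //; lia.
    + by rewrite adj_sym (tree_path_induced x0 ac so us) ?ixy //; lia.
    + by rewrite ixy adj_irrefl; lia.
suff ind k (S : {set T}) a d : #|~: S| <= k -> St S a d -> exists a d, St setT a d.
  exact: ind (leqnn _) base.
elim: k S a d => [|k IH] S a d.
  rewrite leqn0 cards_eq0 => /eqP E H; exists a, d.
  by rewrite -(setCK S) E setC0 in H.
move=> Sk HSt; have [[sS Sc sa] [aS inj adjS dn]] := HSt.
have [ST|nST] := eqVneq (~: S) set0; first by apply: IH HSt; rewrite ST cards0.
have [x [y [xS yS xy]]] : exists x y, [/\ x \notin S, y \in S & adj x y].
  have [u] := set0Pn _ nST; rewrite inE => uS.
  apply: contrapT => H.
  have h0 : nth x0 s 0 \in S by apply: sS; rewrite mem_nth.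
  case/negP: uS; apply: (@connect_invariant _ (@adj T) (mem S) _ u _ h0 (Tc _ _)).
  move=> v w vS vw; apply: contraT => wS; case: H; exists w, v; split => //.
  by rewrite adj_sym.
have xuniq z : z \in S -> adj x z = (z == y).
  move=> zS; apply/idP/eqP => [xz|-> //].
  exact: (tree_unique_attachment ac Sc xS yS zS xy xz).
have d0s z : z \in S -> d z = 0 -> z \in s.
  move=> zS dz; have an := aS z zS; have ms : nth x0 s (a z) \in s by rewrite mem_nth.
  have [aE dE] := sa _ ms; rewrite index_uniq // in aE.
  by rewrite (inj z (nth x0 s (a z))) ?aE ?dE ?dz //; apply: sS.
have xs : x \notin s by apply: contra xS => /sS.
(* The place above [y] is free: a second vertex there would give a spine vertex [y] degree four, and
   a leg vertex [y] degree three off the spine. *)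
have fresh z : z \in S -> a z = a y -> d z <> (d y).+1.
  move=> zS az dz; have yz : adj y z by rewrite adjS // /comb_adj /= az dz !eqxx orbT.
  have zs : z \notin s by apply/negP => /sa [_]; rewrite dz.
  have nxz : x != z by apply: contra xS => /eqP ->.
  have [ys|ys] := boolP (y \in s).
    have /andP [i0 i1] := send x y xs xy ys; set i := index y s in i0 i1.
    have Ey : nth x0 s i = y by apply: nth_index.
    pose l := [:: x; z; nth x0 s i.-1; nth x0 s i.+1].
    have i2 : i.+1 < n by rewrite -ltn_predRL.
    have i4 : i < n by apply: ltnW.
    have i3 : i.-1 < n by apply: leq_ltn_trans (leq_pred i) i4.
    have m1 : nth x0 s i.-1 \in s by apply: mem_nth i3.
    have m2 : nth x0 s i.+1 \in s by apply: mem_nth i2.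
    have ul : uniq l.
      rewrite /= !inE !negb_or nxz /= (nth_uniq x0 i3 i2 us).
      have nm u v : u \notin s -> v \in s -> u != v by move=> + vs; apply: contra => /eqP ->.
      by rewrite !nm //= andbT neq_ltn ltnS leq_pred.
    suff /(degree_uniq ul) : {in l, forall u, adj y u} by rewrite /= leqNgt ltnS sub.
    move=> u; rewrite !inE => /or4P [] /eqP -> //; first by rewrite adj_sym.
      rewrite adj_sym -[X in adj _ X]Ey (tree_path_induced x0 ac so us) ?prednK //.
      by rewrite leqnn; apply: i4.
    rewrite -[X in adj X _]Ey (tree_path_induced x0 ac so us) //.
    by rewrite leqnn; apply: i2.
  case dy : (d y) => [|j]; first by rewrite d0s in ys.
  have [w [wS aw dw]] := dn y yS j dy.
  have yw : adj y w by rewrite adjS // /comb_adj /= aw dw dy !eqxx !orbT.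
  suff : 3 <= degree y by move/Hs; rewrite (negbTE ys).
  apply: (@degree_uniq _ y [:: x; z; w]).
    rewrite /= !inE negb_or nxz /= andbT; apply/andP; split.
      by apply: contra xS => /eqP ->.
    by apply/eqP => E; rewrite E dw dy in dz; elim: (j) dz => // j' IHj [].
  by move=> u; rewrite !inE => /or3P [] /eqP -> //; rewrite adj_sym.
pose a' z := if z == x then a y else a z.
pose d' z := if z == x then (d y).+1 else d z.
have ax : a' x = a y by rewrite /a' eqxx.
have dx : d' x = (d y).+1 by rewrite /d' eqxx.
have nx z : z \in S -> z != x by move=> zS; apply: contra xS => /eqP <-.
have aN z : z \in S -> a' z = a z by move=> zS; rewrite /a' (negbTE (nx z zS)).
have dN z : z \in S -> d' z = d z by move=> zS; rewrite /d' (negbTE (nx z zS)).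
have xadj z : z \in S -> adj x z = comb_adj (a y, (d y).+1) (a z, d z).
  move=> zS; rewrite xuniq //; apply/eqP/idP => [->|].
    by rewrite /comb_adj /= !eqxx !orbT.
  rewrite /comb_adj /= => /andP [/eqP az /orP [/eqP dz|/eqP [dz]]]; last exact: inj.
  have [w [wS aw dw]] := dn z zS _ (esym dz).
  by case: (fresh w wS); rewrite ?aw ?dw ?az.
apply: (IH (x |: S) a' d').
  rewrite -ltnS; apply: leq_trans Sk; apply: proper_card; apply/properP; split.
    by rewrite setCS subsetUr.
  by exists x; rewrite ?inE ?eqxx.
split; split.
- by move=> z /sS; rewrite inE orbC => ->.
- have toy z : z \in x |: S -> connect (rel_in (x |: S)) y z.
    rewrite !inE => /predU1P [->|zS].
      by apply: connect1; rewrite /rel_in !inE eqxx yS orbT adj_sym.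
    apply: connect_sub (Sc y z yS zS) => u v /and3P [uS vS uv]; apply: connect1.
    by rewrite /rel_in !inE uS vS !orbT.
  move=> u v uS vS; apply: connect_trans (toy v vS); rewrite rel_in_sym; exact: toy.
- by move=> z zs; rewrite aN ?dN ?sS //; apply: sa.
- by move=> z; rewrite !inE => /predU1P [->|zS]; rewrite ?ax ?aN //; apply: aS.
- move=> u v; rewrite !inE => /predU1P [->|uS] /predU1P [->|vS] //.
  + by rewrite ax dx aN ?dN // => E1 E2; case: (fresh v vS).
  + by rewrite ax dx aN ?dN // => E1 E2; case: (fresh u uS).
  + by rewrite !aN ?dN //; apply: inj.
- move=> u v; rewrite !inE => /predU1P [->|uS] /predU1P [->|vS].
  + by rewrite adj_irrefl comb_adj_irrefl.
  + by rewrite ax dx aN ?dN // xadj.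
  + by rewrite ax dx aN ?dN // adj_sym xadj // comb_adj_sym.
  + by rewrite !aN ?dN //; apply: adjS.
- move=> u; rewrite !inE => /predU1P [->|uS] j.
    by rewrite dx => -[<-]; exists y; rewrite aN ?dN ?inE ?yS ?orbT ?ax.
  rewrite dN // => /(dn u uS) [w [wS aw dw]]; exists w.
  by rewrite !aN ?dN // !inE wS orbT.
Qed.

(** * Subdividing the spine *)

Lemma contains_induced_embedding (G H : sgraph) (phi : H -> G) :
  injective phi -> {mono phi : x y / adj x y} -> contains_induced G H.
Proof.
move=> inj mono; exists [set phi x | x in [set: H]]; set S := [set _ | _ in _].
have ex (u : induced S) : exists x, phi x = val u.
  by have /imsetP [x _ ->] := valP u; exists x.
have inS x : phi x \in S by apply: imset_f; rewrite inE.
have [f Hf] := choice ex; exists f; split.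
  exists (fun x => exist (fun t => t \in S) (phi x) (inS x)).
    by move=> u; apply: val_inj; rewrite /= Hf.
  by move=> x; apply: inj; rewrite Hf.
by move=> u v; rewrite -mono !Hf.
Qed.

Lemma infix_pair (T : eqType) (x0 : T) (s : seq T) k :
  k.+1 < size s -> infix [:: nth x0 s k; nth x0 s k.+1] s.
Proof.
move=> ks; apply/infixP; exists (take k s), (drop k.+2 s).
rewrite -[LHS](cat_take_drop k s); congr cat.
by rewrite (drop_nth x0 (ltnW ks)) (drop_nth x0 ks).
Qed.

Fixpoint spine_pos (m : nat -> nat) (i : nat) : nat :=
  if i is i'.+1 then spine_pos m i' + (m i').+1 else 0.

Lemma spine_pos_mono m i j : (spine_pos m i < spine_pos m j) = (i < j).
Proof.
have inc i' j' : i' < j' -> spine_pos m i' < spine_pos m j'.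
  elim: j' => // j' IH; rewrite ltnS leq_eqVlt => /predU1P [->|/IH] /=; lia.
case: (ltngtP i j) => [/inc //|/inc|->]; last by rewrite ltnn.
by move=> H; apply/negbTE; rewrite -leqNgt ltnW.
Qed.

Lemma spine_pos_inj m : injective (spine_pos m).
Proof.
move=> i j E; case: (ltngtP i j) => // H.
  by have := spine_pos_mono m i j; rewrite E ltnn H.
by have := spine_pos_mono m j i; rewrite E ltnn H.
Qed.

Lemma spine_pos_le m i j : (spine_pos m i <= spine_pos m j) = (i <= j).
Proof. by rewrite leqNgt spine_pos_mono -leqNgt. Qed.

Lemma spine_pos_find m n t : t < spine_pos m n ->
  exists i, i < n /\ spine_pos m i <= t < spine_pos m i.+1.
Proof.
elim: n => // n IH tn; have [/IH [i [ni H]]|nt] := ltnP t (spine_pos m n).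
  by exists i; split=> //; apply: ltnW.
by exists n; rewrite ltnSn nt.
Qed.

Section SpineSubdivision.

Variables (T : sgraph) (n : nat) (a d : T -> nat) (m : nat -> nat).

(* [m i] new vertices are inserted in the [i]-th spine edge. *)
Definition spine_vertex : finType := (T + {i : 'I_n.-1 & 'I_(m i)})%type.

Definition spine_coord (v : spine_vertex) : nat * nat :=
  match v with
  | inl x => (spine_pos m (a x), d x)
  | inr t => (spine_pos m (tag t) + (tagged t).+1, 0)
  end.

(** Reading adjacency off the coordinates makes both the subdivision property and the later
    embeddings statements about pairs of numbers. *)
Definition spine_adj (u v : spine_vertex) : bool :=
  comb_adj (spine_coord u) (spine_coord v).

Fact spine_adj_sym : symmetric spine_adj.
Proof. by move=> u v; apply: comb_adj_sym. Qed.

Fact spine_adj_irrefl : irreflexive spine_adj.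
Proof. by move=> u; apply: comb_adj_irrefl. Qed.

Definition spine_subdivision : sgraph := SGraph spine_adj_sym spine_adj_irrefl.

Hypothesis coords : comb_coords n a d.

Lemma spine_coord_mid (t : {i : 'I_n.-1 & 'I_(m i)}) :
  spine_pos m (tag t) < spine_pos m (tag t) + (tagged t).+1 < spine_pos m (tag t).+1.
Proof. by have := ltn_ord (tagged t); rewrite /=; lia. Qed.

Lemma spine_pos_gap i j t :
  spine_pos m i <= t < spine_pos m i.+1 -> spine_pos m j <= t < spine_pos m j.+1 -> i = j.
Proof.
move=> /andP [i1 i2] /andP [j1 j2].
have := leq_ltn_trans i1 j2; have := leq_ltn_trans j1 i2.
rewrite !spine_pos_mono; lia.
Qed.

Lemma spine_coord_inj : injective spine_coord.
Proof.
have [_ inj _ _ _] := coords.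
have mix x t : spine_coord (inl x) <> spine_coord (inr t).
  move=> [] E _; have H := spine_coord_mid t; rewrite -E in H.
  by move: H; rewrite !spine_pos_mono; lia.
case=> [x|t] [y|t'] //.
- by move=> [/spine_pos_inj E1 E2]; congr inl; apply: inj.
- by move/mix.
- by move/esym/mix.
move=> [E]; congr inr; have H := spine_coord_mid t; have H' := spine_coord_mid t'.
case: t E H => i k; case: t' H' => i' k' /= H' E H.
have Ei : i = i'.
  apply: val_inj; apply: (@spine_pos_gap _ _ (spine_pos m i + k.+1)) => /=.
    by move: H => /=; lia.
  by rewrite E; move: H' => /=; lia.
case: i' / Ei k' H' E => k' _ E; congr existT; apply: val_inj => /=; lia.
Qed.

Lemma spine_coord_bound (v : spine_vertex) : 
  (spine_coord v).1 <= spine_pos m n.-1.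
Proof.
have [an _ _ _ _] := coords; case: v => [x|t] /=.
  by rewrite spine_pos_le; have := an x; lia.
have /andP [_ H] := spine_coord_mid t; apply: leq_trans (ltnW H) _.
by rewrite spine_pos_le.
Qed.

(** Spine positions are natural numbers while inserted vertices are indexed by ordinals; the list is
    empty when there is no [i]-th spine edge. *)
Definition mids (i : nat) : seq spine_vertex :=
  if (insub i : option 'I_n.-1) is Some i' then
    [seq inr (Tagged (fun i : 'I_n.-1 => 'I_(m i)) k) | k <- enum 'I_(m i')]
  else [::].

Lemma mids_coord i : i < n.-1 ->
  map spine_coord (mids i) = [seq (spine_pos m i + k.+1, 0) | k <- iota 0 (m i)].
Proof.
move=> ni; rewrite /mids insubT -map_comp /= -val_enum_ord -map_comp.
by apply: eq_map.
Qed.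

Lemma mem_mids i v : reflect
  (exists t : {i : 'I_n.-1 & 'I_(m i)}, v = inr t /\ val (tag t) = i) (v \in mids i).
Proof.
rewrite /mids; apply: (iffP idP) => [|[[i' k] [-> /= <-]]].
  case: insubP => // i' _ <- /mapP [k _ ->].
  by exists (Tagged (fun i : 'I_n.-1 => 'I_(m i)) k).
by rewrite valK; apply: map_f; rewrite mem_enum.
Qed.

Definition spine_P (x y : T) : seq spine_vertex :=
  if (d x == 0) && (d y == 0) then
    if a y == (a x).+1 then mids (a x)
    else if a x == (a y).+1 then rev (mids (a y)) else [::]
  else [::].

Let Q := @subdivision_path T spine_subdivision inl spine_P.

Lemma spine_PC x y : spine_P y x = rev (spine_P x y).
Proof.
rewrite /spine_P andbC; case: ifP => // _.
case: eqP => [E|nE].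
  by rewrite E; case: eqP => [|_]; [lia|rewrite revK].
by case: eqP => // _; case: eqP.
Qed.

Lemma spine_QC x y : Q y x = rev (Q x y).
Proof. by rewrite /Q /subdivision_path rev_cons rev_rcons spine_PC. Qed.

Lemma spine_P_leg x y : (d x == 0) && (d y == 0) = false -> spine_P x y = [::].
Proof. by rewrite /spine_P => ->. Qed.

(** The path replacing a spine edge runs through consecutive positions of the spine. Sortedness,
    absence of repetitions and the location of its edges all follow from this list of
    coordinates. *)
Lemma spine_Q_coord x y : d x = 0 -> d y = 0 -> a y = (a x).+1 ->
  map spine_coord (Q x y) =
  [seq (spine_pos m (a x) + k, 0) | k <- iota 0 (m (a x)).+2].
Proof.
move=> dx dy axy; have [an _ _ _ _] := coords.
have Ex : spine_coord (inl x) = (spine_pos m (a x) + 0, 0) by rewrite /= dx addn0.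
have Ey : spine_coord (inl y) = (spine_pos m (a x) + (m (a x)).+1, 0).
  by rewrite /= dy axy.
rewrite /Q /subdivision_path map_cons map_rcons Ex Ey /spine_P dx dy axy !eqxx /=.
rewrite mids_coord; last by have := an y; lia.
congr cons.
rewrite -[RHS]/[seq (spine_pos m (a x) + k, 0) | k <- iota (1 + 0) (m (a x)).+1].
rewrite iotaDl -map_comp -[in RHS](addn1 (m (a x))).
by rewrite iotaD map_cat /= cats1 add0n.
Qed.

Lemma spine_P_mem v x y : v \in spine_P x y ->
  exists t, v = inr t /\ 
   ([/\ a x = tag t, a y = (tag t).+1, d x = 0 & d y = 0] \/
    [/\ a y = tag t, a x = (tag t).+1, d x = 0 & d y = 0]).
Proof.
rewrite /spine_P; case: ifP => // /andP [/eqP dx /eqP dy].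
case: eqP => [E|_].
  by move/mem_mids => [t [-> Et]]; exists t; split=> //; left; rewrite E -Et.
case: eqP => // E.
by rewrite mem_rev => /mem_mids [t [-> Et]]; exists t; split=> //; right; rewrite E -Et.
Qed.

Lemma spine_edge_cases x y : adj x y ->
  [\/ [/\ d x = 0, d y = 0 & a y = (a x).+1], [/\ d x = 0, d y = 0 & a x = (a y).+1]
    | (d x == 0) && (d y == 0) = false /\ @adj spine_subdivision (inl x) (inl y)].
Proof.
have [_ _ adjE _ _] := coords; rewrite adjE /comb_adj /=.
case/orP => [/and3P [/eqP dx /eqP dy /orP [/eqP E|/eqP E]]|/andP [/eqP E Hd]].
- by constructor 1.
- by constructor 2.
constructor 3; split; first lia.
by rewrite /= /spine_adj /comb_adj /= E eqxx Hd orbT.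
Qed.

Lemma spine_Q_ok x y : d x = 0 -> d y = 0 -> a y = (a x).+1 ->
  sorted (@adj spine_subdivision) (Q x y) && uniq (Q x y).
Proof.
move=> dx dy E; have EQ := spine_Q_coord dx dy E; apply/andP; split.
  suff : sorted comb_adj (map spine_coord (Q x y)) by rewrite sorted_map.
  rewrite EQ sorted_map /=.
  have pth k i : path (relpre (fun k => (spine_pos m (a x) + k, 0)) comb_adj)
      i (iota i.+1 k).
    by elim: k i => //= k IH i; rewrite IH andbT /comb_adj /= addnS eqxx.
  exact: (pth (m (a x)).+1 0).
apply: (map_uniq (f := spine_coord)); rewrite EQ map_inj_uniq ?iota_uniq //.
by move=> u v [] /addnI.
Qed.

Lemma is_subdivision_spine : is_subdivision T spine_subdivision.
Proof.
have [an inj adjE spn dn] := coords.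
exists (inl : T -> spine_subdivision), spine_P; rewrite -/Q; split.
- by move=> x y [].
- move=> x y /spine_edge_cases [[dx dy E]|[dx dy E]|[dxy xy]].
  + have /andP [so un] := spine_Q_ok dx dy E.
    by split; [exact: spine_PC|exact: so|exact: un].
  + rewrite spine_QC rev_uniq rev_sorted; have /andP [so un] := spine_Q_ok dy dx E.
    split; [exact: spine_PC| |exact: un].
    by rewrite (eq_sorted (e' := @adj spine_subdivision)) // => u v; apply: adj_sym.
  + rewrite /Q /subdivision_path !spine_P_leg //=; last by rewrite andbC.
    split; [by []|by rewrite andbT; exact: xy|].
    by rewrite inE andbT; apply/eqP => -[E]; rewrite E adj_irrefl in xy.
- split; first by move=> x y z _; apply/negP => /spine_P_mem [t []].
  move=> x y x' y' v _ _ /spine_P_mem [t [-> H]] /spine_P_mem [t' [[<-] H']].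
  have eqv u w : a u = a w -> d u = d w -> u = w by apply: inj.
  case: H => [] [E1 E2 E3 E4]; case: H' => [] [F1 F2 F3 F4].
  + have -> : x = x' by apply: eqv; rewrite ?E1 ?E3.
    by have -> : y = y' by apply: eqv; rewrite ?E2 ?E4.
  + rewrite setUC; have -> : x = y' by apply: eqv; rewrite ?E1 ?E3.
    by have -> : y = x' by apply: eqv; rewrite ?E2 ?E4.
  + rewrite setUC; have -> : y = x' by apply: eqv; rewrite ?E1 ?E4.
    by have -> : x = y' by apply: eqv; rewrite ?E2 ?E3.
  + have -> : y = y' by apply: eqv; rewrite ?E1 ?E4.
    by have -> : x = x' by apply: eqv; rewrite ?E2 ?E3.
- case=> [x|t]; [by left; exists x|right].
  have [|x ax dx] := spn (tag t); first by have := ltn_ord (tag t); lia.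
  have [|y ay dy] := spn (tag t).+1; first by have := ltn_ord (tag t); lia.
  exists x, y; rewrite adjE /comb_adj /= ax ay dx dy; split; first by rewrite !eqxx.
  by rewrite /spine_P ax ay dx dy !eqxx /=; apply/mem_mids; exists t.
(* Two consecutive spine positions lie on the path replacing a single edge, found as the gap between
   original vertices that contains the lower position. *)
have step u v : (spine_coord u).2 = 0 -> (spine_coord v).2 = 0 ->
    (spine_coord u).1.+1 = (spine_coord v).1 ->
    exists x y, [/\ adj x y, adj y x & infix [:: u; v] (Q x y)].
  move=> u0 v0 E.
  have [|i [ni /andP [i1 i2]]] := @spine_pos_find m n.-1 (spine_coord u).1.
    by rewrite E; apply: spine_coord_bound.
  have [|x ax dx] := spn i; first lia.
  have [|y ay dy] := spn i.+1; first lia.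
  have xy : adj x y by rewrite adjE /comb_adj /= ax ay dx dy !eqxx.
  exists x, y; split=> //; first by rewrite adj_sym.
  have EQ := spine_Q_coord dx dy (etrans ay (congr1 S (esym ax))).
  have sQ : size (Q x y) = (m i).+2 by rewrite -(size_map spine_coord) EQ size_map size_iota ax.
  have Hnth k w : k < (m i).+2 -> spine_coord w = (spine_pos m i + k, 0) ->
      w = nth u (Q x y) k.
    move=> km Ew; apply: spine_coord_inj.
    rewrite -(nth_map u (0, 0)) ?sQ // EQ (nth_map 0) ?size_iota ?ax //.
    by rewrite nth_iota // Ew.
  have [k Ek km] : exists2 k, (spine_coord u).1 = spine_pos m i + k & k <= m i.
    exists ((spine_coord u).1 - spine_pos m i); first by rewrite subnKC.
    by rewrite leq_subLR -ltnS -addnS.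
  have Eu : u = nth u (Q x y) k.
    by apply: Hnth; [apply: leqW|rewrite [LHS]surjective_pairing u0 Ek].
  have Ev : v = nth u (Q x y) k.+1.
    by apply: Hnth; [|rewrite [LHS]surjective_pairing v0 -E Ek addnS].
  have ks : k.+1 < size (Q x y) by rewrite sQ.
  by have := infix_pair u ks; rewrite -Eu -Ev.
move=> u v; rewrite -[adj u v]/(comb_adj (spine_coord u) (spine_coord v)) /comb_adj.
case/orP => [/and3P [/eqP u0 /eqP v0 /orP [/eqP E|/eqP E]]|/andP [/eqP E Hd]].
- by have [x [y [xy _ H]]] := step u v u0 v0 E; exists x, y.
- have [x [y [_ yx H]]] := step v u v0 u0 E; exists y, x; split=> //.
  by rewrite spine_QC -[[:: u; v]]/(rev [:: v; u]) infix_rev.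
case: u v E Hd => [x|t] [y|t'] E Hd; rewrite /= in E Hd; last by [].
- exists x, y; have xy : adj x y by rewrite adjE /comb_adj /= (spine_pos_inj E) eqxx Hd orbT.
  have dxy : (d x == 0) && (d y == 0) = false.
    by move: Hd; case: (d x) => [|j]; case: (d y).
  split=> //; rewrite /Q /subdivision_path (spine_P_leg dxy); exact: infix_refl.
- have := spine_coord_mid t'; rewrite -E !spine_pos_mono; lia.
- have := spine_coord_mid t; rewrite E !spine_pos_mono; lia.
Qed.

(** * Line graphs of the subdivided comb, each edge coded by its end farther from the root *)

Definition comb_parent (c : nat * nat) : nat * nat :=
  if c.2 is j.+1 then (c.1, j) else (c.1.-1, 0).

(* The edge from [c] to its parent is coded by [c], the root being [(0, 0)]. *)
Definition comb_line_adj (c1 c2 : nat * nat) : bool :=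
  (c1 != c2) && [|| c1 == comb_parent c2, comb_parent c1 == c2
                  | comb_parent c1 == comb_parent c2].

Lemma comb_line_adj_sym : symmetric comb_line_adj.
Proof.
move=> c1 c2; rewrite /comb_line_adj eq_sym (eq_sym c1 (comb_parent c2)).
by rewrite (eq_sym (comb_parent c1) c2) (eq_sym (comb_parent c1)) orbCA.
Qed.

Lemma comb_adj_parent c1 c2 : comb_adj c1 c2 ->
  (c1 <> (0, 0) /\ c2 = comb_parent c1) \/ (c2 <> (0, 0) /\ c1 = comb_parent c2).
Proof.
case: c1 c2 => [i j] [i' j']; rewrite /comb_adj /comb_parent /=.
case/orP => [/and3P [/eqP -> /eqP -> /orP [] /eqP <-]|/andP [/eqP -> /orP [] /eqP <-]] /=.
- by right; split=> // -[].
- by left; split=> // -[].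
- by right; split=> // -[].
- by left; split=> // -[].
Qed.

(** Edges correspond to non-root vertices, so nothing is asked of [phi] at [(0, 0)]. Two distinct
    edges meet exactly when the lower end of one is the upper end of the other or their upper ends
    agree. *)
Lemma contains_line_spine_subdivision (G : sgraph) (phi : spine_vertex -> G) :
  (forall u v, spine_coord u <> (0, 0) -> spine_coord v <> (0, 0) ->
     phi u = phi v -> u = v) ->
  (forall u v, spine_coord u <> (0, 0) -> spine_coord v <> (0, 0) ->
     adj (phi u) (phi v) = comb_line_adj (spine_coord u) (spine_coord v)) ->
  contains_induced G (line_graph spine_subdivision).
Proof.
move=> inj mono.
have ex (e : line_graph spine_subdivision) : exists uv : spine_vertex * spine_vertex,
    [/\ val e = [set uv.1; uv.2], spine_coord uv.1 <> (0, 0)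
      & spine_coord uv.2 = comb_parent (spine_coord uv.1)].
  have := valP e; rewrite inE => /existsP [u /existsP [v /andP [uv /eqP E]]].
  case: (comb_adj_parent uv) => [[u0 vp]|[v0 up]]; first by exists (u, v).
  by exists (v, u); rewrite E setUC.
have [ch Hch] := choice ex.
have chP e1 e2 : (spine_coord (ch e1).1 == spine_coord (ch e2).1) = (e1 == e2).
  apply/eqP/eqP => [E|-> //]; have [E1 _ P1] := Hch e1; have [E2 _ P2] := Hch e2.
  apply: val_inj; rewrite E1 E2; congr [set _; _]; apply: spine_coord_inj => //.
  by rewrite P1 P2 E.
apply: (@contains_induced_embedding G (line_graph spine_subdivision)
  (fun e => phi (ch e).1)).
  move=> e1 e2 E; apply/eqP; rewrite -chP; apply/eqP; congr spine_coord; apply: inj => //.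
    by have [] := Hch e1.
  by have [] := Hch e2.
move=> e1 e2; have [E1 N1 P1] := Hch e1; have [E2 N2 P2] := Hch e2.
rewrite mono // /= /line_adj /comb_line_adj chP; case: eqVneq => //= ne.
have ce := inj_eq spine_coord_inj.
rewrite -P1 -P2 !ce E1 E2; apply/idP/set0Pn => [H|[z]].
  case/or3P: H => /eqP H.
  - by exists (ch e1).1; rewrite !inE eqxx H eqxx orbT.
  - by exists (ch e2).1; rewrite !inE eqxx H eqxx orbT.
  - by exists (ch e1).2; rewrite !inE eqxx H eqxx !orbT.
rewrite !inE => /andP [/orP [] /eqP -> /orP [] /eqP H].
- by move: ne; rewrite -chP H eqxx.
- by rewrite H eqxx.
- by rewrite H eqxx orbT.
- by rewrite H eqxx !orbT.
Qed.

End SpineSubdivision.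

(** * Embedding subdivisions and their line graphs *)

Definition consec (i j : nat) : bool := (i.+1 == j) || (j.+1 == i).

Lemma spine_pos_step m i j : i < j -> spine_pos m i + m i < spine_pos m j.
Proof. by rewrite -(spine_pos_le m) /=; lia. Qed.

(* The branch vertex [leg i 0] sits between the path vertices [p (e i).-1] and
   [p (s i)]; the path vertices strictly between these two are skipped. *)
Lemma claw_embedding (T G : sgraph) n (a d : T -> nat) l (ok : pred nat)
    (p : nat -> G) (e s : nat -> nat) (leg : nat -> nat -> G) :
  comb_coords n a d -> (forall x, d x <= l) ->
  (forall t t', ok t -> ok t' -> p t = p t' -> t = t') ->
  (forall t t', ok t -> ok t' -> adj (p t) (p t') = consec t t') ->
  (forall i j, i < j < n -> s i < e j) -> (forall i, i < n -> e i < s i) ->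
  (forall i t, i.+1 < n -> s i <= t < e i.+1 -> ok t) ->
  (forall i i' j j', i < n -> i' < n -> j <= l -> j' <= l ->
     leg i j = leg i' j' -> i = i' /\ j = j') ->
  (forall i i' j j', i < n -> i' < n -> j <= l -> j' <= l ->
     adj (leg i j) (leg i' j') = (i == i') && consec j j') ->
  (forall i j t, i < n -> j <= l -> ok t -> leg i j <> p t) ->
  (forall i j t, i < n -> j <= l -> ok t ->
     adj (leg i j) (p t) = (j == 0) && ((t.+1 == e i) || (t == s i))) ->
  exists2 H, is_subdivision T H & contains_induced G H.
Proof.
move=> co dl pinj padj se es okst linj ladj lp lpadj.
have [an inj _ _ _] := co.
(* The path vertices from [s i] up to, but excluding, [e i.+1] become the inserted ones. There is at
   least one, as required, because distinct branch vertices are not adjacent in [G]. *)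
pose m i := e i.+1 - s i.
exists (spine_subdivision n a d m); first exact: is_subdivision_spine.
pose phi (v : spine_vertex T n m) : G :=
  match v with
  | inl x => leg (a x) (d x)
  | inr t => p (s (tag t) + tagged t) end.
have step i j : i < j < n -> s i + m i < s j /\ s i + m i <= e j.
  move=> /andP [ij jn].
  have Ee : s i + m i = e i.+1.
    by rewrite /m subnKC // ltnW // se // ltnSn (leq_ltn_trans ij).
  rewrite Ee; move: ij; rewrite leq_eqVlt => /predU1P [->|ij]; first by rewrite es ?leqnn.
  have := se i.+1 j; have := es i.+1; have := es j; rewrite ij jn /=.
  have := ltn_trans ij jn => /= h1 /(_ isT) h2 /(_ h1) h3 /(_ isT) h4.
  by clear -h2 h3 h4; lia.
have midP (t : {i : 'I_n.-1 & 'I_(m i)}) :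
    [/\ tag t < n, (tag t).+1 < n, tagged t < m (tag t),
        s (tag t) + m (tag t) = e (tag t).+1 & ok (s (tag t) + tagged t)].
  have i1 : (tag t).+1 < n by have := ltn_ord (tag t); rewrite ltn_predRL.
  have k1 := ltn_ord (tagged t).
  have Ee : s (tag t) + m (tag t) = e (tag t).+1.
    by rewrite /m subnKC // ltnW // se // ltnSn.
  split=> //; first exact: ltnW.
  by apply: okst i1 _; rewrite leq_addr -Ee ltn_add2l.
have m_gt0 i : i.+1 < n -> 0 < m i by move=> i1; rewrite subn_gt0 se ?ltnSn.
have phi_adj u v : adj (phi u) (phi v) = comb_adj (spine_coord a d u) (spine_coord a d v).
  have mix x t : adj (phi (inl x)) (phi (inr t)) =
      comb_adj (spine_coord a d (inl x : spine_vertex T n m)) (spine_coord a d (inr t)).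
    have [t0 t1 km Ee okt] := midP t.
    rewrite /phi lpadj //= /comb_adj /=; have := an x.
    move: (a x) (d x) (tag t) (nat_of_ord (tagged t)) t0 t1 km Ee {okt} => i' j i k t0 t1 km Ee i'n.
    case: (ltngtP i' i) => ii.
    - have [|h1 h2] := step i' i; first by rewrite ii.
      have h3 := spine_pos_step m ii; have h4 := es i' i'n.
      by clear -h1 h2 h3 h4; lia.
    - have h3 := spine_pos_step m ii.
      have h4 := es i' i'n; have h5 : e i.+1 <= e i' /\ (i.+1 < i' -> e i.+1 < e i').
        move: ii; rewrite leq_eqVlt => /predU1P [->|ii]; first by rewrite leqnn ltnn.
        have [|h6 h7] := step i.+1 i'; first by rewrite ii.
        have h8 := es i.+1 t1; by clear -h6 h7 h8; lia.
      have [Ei|nEi] := eqVneq i.+1 i'.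
        have : spine_pos m i' = spine_pos m i + (m i).+1 by rewrite -Ei.
        by rewrite -Ei in h4 *; clear -h4 Ee km; lia.
      have h6 : spine_pos m i.+1 < spine_pos m i'.
        by rewrite spine_pos_mono ltn_neqAle nEi.
      have h7 : e i.+1 < e i' by case: h5 => _; apply; rewrite ltn_neqAle nEi.
      by rewrite /= in h6; clear -h4 h6 h7 Ee km; lia.
    - by rewrite ii; have h4 := es i t0; clear -h4 km Ee; lia.
  case: u v => [x|t] [y|t'].
  - rewrite /phi ladj // /comb_adj /= (inj_eq (@spine_pos_inj m)).
    case: eqP => [->|nE] /=; first by rewrite /consec; lia.
    rewrite orbF; apply/esym/negP => /and3P [_ _ H].
    have h i j : i < j -> j < n -> (spine_pos m i).+1 == spine_pos m j = false.
      move=> ij jn; have h1 := spine_pos_step m ij.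
      have h2 := m_gt0 i (leq_ltn_trans ij jn); by clear -h1 h2; lia.
    by case: (ltngtP (a x) (a y)) => // ij; move: H; rewrite (h _ _ ij) //= eqn_leq leqNgt;
      have := ij; rewrite -(spine_pos_mono m) => ij'; clear -ij ij'; lia.
  - exact: mix.
  - by rewrite adj_sym mix comb_adj_sym.
  have [t0 t1 km Ee okt] := midP t; have [t0' t1' km' Ee' okt'] := midP t'.
  rewrite /phi padj // /comb_adj /= /consec.
  move: (tag t) (nat_of_ord (tagged t)) (tag t') (nat_of_ord (tagged t'))
    t0 t1 km Ee t0' t1' km' Ee'
    {okt okt'} => i k i' k' t0 t1 km Ee t0' t1' km' Ee'.
  case: (ltngtP i i') => ii.
  - have [|h1 h2] := step i i'; first by rewrite ii.
    by have h3 := spine_pos_step m ii; have h4 := es i' t0'; clear -h1 h2 h3 h4 km km'; lia.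
  - have [|h1 h2] := step i' i; first by rewrite ii.
    by have h3 := spine_pos_step m ii; have h4 := es i t0; clear -h1 h2 h3 h4 km km'; lia.
  - by rewrite ii; clear; lia.
apply: (@contains_induced_embedding G (spine_subdivision n a d m) phi) => //.
case=> [x|t] [y|t'].
- by move=> /linj [] // E1 E2; congr inl; apply: inj.
- by have [_ _ _ _ okt] := midP t'; move/lp; case.
- by have [_ _ _ _ okt] := midP t; move/esym/lp; case.
have [t0 t1 km Ee okt] := midP t; have [t0' t1' km' Ee' okt'] := midP t'.
move=> E0; have E := pinj _ _ okt okt' E0; apply: (spine_coord_inj co) => /=; congr pair.
move: E km km' t0 t0' => {E0}.
move: (tag t) (nat_of_ord (tagged t)) (tag t') (nat_of_ord (tagged t'))
  => i k i' k' E km km' t0 t0'.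
case: (ltngtP i i') => ii.
- by have [|h1 h2] := step i i'; [rewrite ii|clear -h1 h2 km E; lia].
- by have [|h1 h2] := step i' i; [rewrite ii|clear -h1 h2 km' E; lia].
- by rewrite ii in E *; clear -E; lia.
Qed.

(** Path vertices play the spine edges and [leg i j] the leg edge whose far end has height [j.+1],
    hence the bound [l.+1]. The three edges at a branch vertex become [p (f i)], [p (f i).+1] and
    [leg i 0], which is the triangle. *)
Lemma triangle_embedding (T G : sgraph) n (a d : T -> nat) l (ok : pred nat)
    (p : nat -> G) (f : nat -> nat) (leg : nat -> nat -> G) :
  comb_coords n a d -> (forall x, d x <= l.+1) ->
  (forall t t', ok t -> ok t' -> p t = p t' -> t = t') ->
  (forall t t', ok t -> ok t' -> adj (p t) (p t') = consec t t') ->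
  (forall i j, i < j < n -> (f i).+1 < f j) ->
  (forall t, t <= f n.-1 -> ok t) ->
  (forall i i' j j', i < n -> i' < n -> j <= l -> j' <= l ->
     leg i j = leg i' j' -> i = i' /\ j = j') ->
  (forall i i' j j', i < n -> i' < n -> j <= l -> j' <= l ->
     adj (leg i j) (leg i' j') = (i == i') && consec j j') ->
  (forall i j t, i < n -> j <= l -> ok t -> leg i j <> p t) ->
  (forall i j t, i < n -> j <= l -> ok t ->
     adj (leg i j) (p t) = (j == 0) && ((t == f i) || (t == (f i).+1))) ->
  exists2 H, is_subdivision T H & contains_induced G (line_graph H).
Proof.
move=> co dl pinj padj ff okf linj ladj lp lpadj.
have [an inj _ _ _] := co.
(* Chosen so that the [i]-th spine vertex gets position [f i] minus [f 0]. *)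
pose m i := f i.+1 - (f i).+1.
exists (spine_subdivision n a d m); first exact: is_subdivision_spine.
have posE i : i < n -> f 0 + spine_pos m i = f i.
  elim: i => [|i IH] i1; first by rewrite /= addn0.
  have h1 := IH (ltnW i1); have := ff i i.+1; rewrite ltnSn i1 => /(_ isT) h2.
  have Em : m i = f i.+1 - (f i).+1 by [].
  by rewrite /=; move: (m i) (spine_pos m i) Em h1 h2 => mi q; clear; lia.
(* The value [p 0] is never taken: inserted vertices have height 0. *)
pose phi (v : spine_vertex T n m) : G :=
  let c := spine_coord a d v in
  if c.2 is j.+1 then (if v is inl x then leg (a x) j else p 0) else p (f 0 + c.1).
have sp (v : spine_vertex T n m) :
    (spine_coord a d v).2 = 0 -> phi v = p (f 0 + (spine_coord a d v).1).
  by rewrite /phi => ->.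
have spok (v : spine_vertex T n m) : ok (f 0 + (spine_coord a d v).1).
  apply: okf; have b := spine_coord_bound co v.
  have n0 : n.-1 < n.
    rewrite ltn_predL; case: v {b} => [x|t]; first exact: leq_ltn_trans (an x).
    by have := ltn_ord (tag t); rewrite ltn_predRL; apply: leq_ltn_trans.
  by rewrite -(posE _ n0) leq_add2l.
have cases (v : spine_vertex T n m) : (spine_coord a d v).2 = 0 \/
    exists i j, [/\ i < n, j <= l, spine_coord a d v = (spine_pos m i, j.+1) & phi v = leg i j].
  case: v => [x|t]; last by left.
  case dx : (d x) => [|j]; first by left; rewrite /= dx.
  right; exists (a x), j; rewrite /phi /= dx; split=> //.
  by have := dl x; rewrite dx ltnS.
have nz (v : spine_vertex T n m) : spine_coord a d v <> (0, 0) ->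
    (spine_coord a d v).2 = 0 -> 0 < (spine_coord a d v).1.
  by case: (spine_coord a d v) => [[|t] j] //= + E; rewrite E.
have mixadj i j t :
    i < n -> j <= l -> ok (f 0 + t) -> 0 < t ->
    adj (leg i j) (p (f 0 + t)) = comb_line_adj (spine_pos m i, j.+1) (t, 0).
  move=> i0 jl okt t0; rewrite lpadj // -(posE i i0) /comb_line_adj /comb_parent /= !xpair_eqE.
  by move: (spine_pos m i) t0 (f 0) => q t0 f0; clear -t0; lia.
apply: (@contains_line_spine_subdivision T n a d m co G phi).
- move=> u v /nz u0 /nz v0 E; apply: (spine_coord_inj co).
  case: (cases u) => [u2|[i [j [i0 jl cu pu]]]]; case: (cases v) => [v2|[i' [j' [i0' jl' cv pv]]]].
  + move: E; rewrite !sp // => E.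
    have /addnI E1 := pinj _ _ (spok u) (spok v) E.
    by rewrite [LHS]surjective_pairing [RHS]surjective_pairing E1 u2 v2.
  + by move: E; rewrite sp // pv => /esym /lp; case.
  + by move: E; rewrite (sp v) // pu => /lp; case.
  + by rewrite cu cv; move: E; rewrite pu pv => /linj [] // -> ->.
move=> u v /nz u0 /nz v0.
case: (cases u) => [u2|[i [j [i0 jl cu pu]]]]; case: (cases v) => [v2|[i' [j' [i0' jl' cv pv]]]].
- rewrite !sp // padj //.
  have := u0 u2; have := v0 v2.
  rewrite [X in comb_line_adj X](surjective_pairing _) [X in comb_line_adj _ X](surjective_pairing _).
  rewrite u2 v2; move: (spine_coord a d u).1 (spine_coord a d v).1 (f 0) => t t' f0 {}v0 {}u0.
  rewrite /comb_line_adj /comb_parent /consec /= !xpair_eqE.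
  by clear -u0 v0; lia.
- rewrite (sp u) // pv adj_sym mixadj //; last exact: u0.
  by rewrite cv comb_line_adj_sym -u2 -surjective_pairing.
- rewrite (sp v) // pu mixadj //; last exact: v0.
  by rewrite cu -v2 -surjective_pairing.
rewrite pu pv cu cv ladj // -(inj_eq (@spine_pos_inj m)).
rewrite /comb_line_adj /comb_parent /= !xpair_eqE /consec.
by move: (spine_pos m i) (spine_pos m i') => q q'; clear; lia.
Qed.

(** * Fans *)

Lemma induced_path_nth (G : sgraph) (x0 : G) (s : seq G) : induced_path s ->
  uniq s /\ forall i j, i < size s -> j < size s ->
    adj (nth x0 s i) (nth x0 s j) = consec i j.
Proof.
elim: s => // v p IH /= /and3P [vp /IH [-> H] Hv]; rewrite vp; split=> //.
have adj0 j : j < size p -> adj v (nth x0 p j) = (j == 0).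
  case: p Hv {IH H vp} => // u p /andP [vu /allP Hp]; case: j => [|j] //= jp.
  by apply/negbTE/Hp; rewrite mem_nth.
case=> [|i] [|j] //=; rewrite ?ltnS => ip jp.
- by rewrite adj_irrefl.
- by rewrite adj0 // /consec eqSS orbF eq_sym.
- by rewrite adj_sym adj0 // /consec eqSS eq_sym.
- by rewrite H.
Qed.

(* An induced path [p] and, for each [w] in [ws], a leg [c w] starting at
   [c w 0], whose neighbours on [p] lie between the positions [f w] and [g w]. *)
Definition fan (G : sgraph) (l : nat) (ok : pred nat) (p : nat -> G) (ws : seq G)
    (f g : G -> nat) (c : G -> nat -> G) : Prop :=
  [/\ forall t t', t <= t' -> ok t' -> ok t,
      forall t t', ok t -> ok t' -> p t = p t' -> t = t',
      forall t t', ok t -> ok t' -> adj (p t) (p t') = consec t t'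
    & pairwise (fun u v => (g u).+1 < f v) ws] /\
  [/\ {in ws, forall w, [/\ f w <= g w, ok (g w),
        adj (c w 0) (p (f w)) & adj (c w 0) (p (g w))]},
      {in ws, forall w j t, j <= l -> ok t -> c w j <> p t},
      {in ws, forall w j t, j <= l -> ok t -> adj (c w j) (p t) ->
         j = 0 /\ f w <= t <= g w},
      {in ws &, forall w w' j j', j <= l -> j' <= l -> c w j = c w' j' ->
         w = w' /\ j = j'}
    & {in ws &, forall w w' j j', j <= l -> j' <= l ->
         adj (c w j) (c w' j') = (w == w') && consec j j'}].

Lemma fan_exists (Delta l K : nat) :
  exists s, forall G : sgraph, max_degree G <= Delta ->
  forall v q (C : {set G}), path_state v q C -> s < #|bnd C| ->
  exists (ok : pred nat) p ws f g c, size ws = K /\ @fan G l ok p ws f g c.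
Proof.
(* At least two distant vertices are wanted, so that a neighbour in [C] of another one gives each
   leg a far target. [R] covers two legs and an edge between them, as well as distance 3 through two
   consecutive path vertices. *)
pose N := maxn (disjoint_bound Delta K) 2; pose R := l + l + 3.
exists (N * Delta.+1 ^ R) => G GD v q C [ip Cc vb qC bq] bs.
(* The end [v] of the path is dropped: the fan uses only [q], none of whose vertices touches [C], so
   legs meet the path only at their origins. The strict inequality on [bnd C] pays for [v]. *)
have := leq_trans bs (_ : #|bnd C| <= #|bnd C :\ v|.+1).
rewrite (cardsD1 v (bnd C)) vb add1n leqnn ltnS => /(_ isT) {}bs.
have [W [WC WN far]] := far_subset GD bs.
have Wb w : w \in W -> w \in bnd C by move/(subsetP WC) => /setD1P [].
have WD : disjoint_bound Delta K <= #|W| by apply: leq_trans WN; apply: leq_maxl.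
have W2 : 2 <= #|W| by apply: leq_trans WN; apply: leq_maxr.
have nfar w w' r : w \in W -> w' \in W -> w' \in ball r w -> r <= R -> w = w'.
  move=> wW wW' b rR; apply/eqP; apply: contraT => nw.
  have := far w' w wW' wW; rewrite eq_sym nw => /(_ isT) /negP; case.
  exact: (subsetP (ball_mono w rR)).
have legs w : exists c : nat -> G, w \in W ->
    [/\ c 0 = w, forall j, 0 < j <= l -> c j \in C, forall j, j <= l -> c j \in ball j w,
      forall i j, i <= l -> j <= l -> c i = c j -> i = j
    & forall i j, i <= l -> j <= l -> adj (c i) (c j) = consec i j].
  have [wW|wW] := boolP (w \in W); last by exists (fun=> w).
  have [w' wW' nw] : exists2 w', w' \in W & w' != w.
    have : 0 < #|W :\ w| by move: W2; rewrite (cardsD1 w W) wW.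
    by move=> /card_gt0P [w' /setD1P [? ?]]; exists w'.
  have /bndP [_ [z zC zw]] := Wb w' wW'.
  have zb : z \notin ball l w.
    apply: contra nw => zb; apply/eqP/esym; apply: (nfar w w' (l + 1)) => //.
      by apply: ball_trans zb _; apply: ball_adj.
    by rewrite /R; clear; lia.
  by have [c Hc] := leg_exists Cc (Wb w wW) zC zb; exists c.
have [c Hc] := choice legs.
pose p t := nth v q t.
have {}ip : induced_path q by move: ip => /= /and3P [].
have [uq adjq] := induced_path_nth v ip.
have pC t : t < size q -> (p t \notin C) && (p t \notin bnd C).
  by move=> tq; apply: qC; rewrite mem_nth.
pose nb w := [seq t <- iota 0 (size q) | adj w (p t)].
have nbP w t : (t \in nb w) = (t < size q) && adj w (p t).
  by rewrite mem_filter mem_iota andbC.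
have Hnb : {in W, forall w, [/\ nb w != [::], sorted ltn (nb w) & size (nb w) <= Delta]}.
  move=> w wW; split.
  - have /setD1P [wv wb] := subsetP WC w wW; have [u uq' uw] := bq w wb wv.
    apply/eqP => E; have : index u q \in nb w by rewrite nbP index_mem uq' /p nth_index // adj_sym.
    by rewrite E.
  - by apply: (sorted_filter ltn_trans); apply: iota_ltn_sorted.
  apply: leq_trans GD; apply: leq_trans (_ : degree w <= _); last exact: (bigmax_sup w).
  rewrite -(size_map p); apply: degree_uniq.
    rewrite map_inj_in_uniq ?filter_uniq ?iota_uniq // => t t'.
    rewrite !nbP => /andP [tq _] /andP [tq' _] /eqP; rewrite nth_uniq //; exact: eqP.
  by move=> z /mapP [t]; rewrite nbP => /andP [_ H] ->.
have dis : {in W &, forall u w x, x \in nb u -> x \in nb w -> u = w}.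
  move=> u w uW wW x; rewrite !nbP => /andP [_ ux] /andP [_ wx].
  apply: (nfar u w (1 + 1)) => //; last by rewrite /R; clear; lia.
  by apply: (ball_trans (u := p x)); apply: ball_adj; rewrite // adj_sym.
have [ok [ws [okd sz sub ne pw]]] := disjoint_spans WD Hnb dis.
pose nb' w := [seq x <- nb w | ok x].
have nb'P w t : (t \in nb' w) = [&& ok t, t < size q & adj w (p t)].
  by rewrite mem_filter nbP.
pose f w := head 0 (nb' w); pose g w := last 0 (nb' w).
have fnb w : w \in ws -> f w \in nb' w.
  by move=> /ne; rewrite /f -/(nb' w); case: (nb' w) => // x s _; rewrite mem_head.
have gnb w : w \in ws -> g w \in nb' w.
  by move=> /ne; rewrite /g -/(nb' w); case: (nb' w) => // x s _; rewrite /= mem_last.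
have fg w t : w \in ws -> t \in nb' w -> f w <= t <= g w.
  move=> ww; apply: sorted_bounds; apply: (sorted_filter ltn_trans).
  by have [] := Hnb w (sub w ww).
have ok' t t' : t <= t' -> ok t' && (t' < size q) -> ok t && (t < size q).
  by move=> tt /andP [o q']; rewrite (okd _ _ o tt) (leq_ltn_trans tt q').
have c0 w : w \in ws -> c w 0 = w by move=> /sub /Hc [].
have cpos w j : w \in ws -> 0 < j <= l -> c w j \in C by move=> /sub /Hc [_ H _ _ _] /H.
have cball w j : w \in ws -> j <= l -> c w j \in ball j w.
  by move=> /sub /Hc [_ _ H _ _] /H.
exists (fun t => ok t && (t < size q)), p, ws, f, g, c; split=> //; split; split.
- exact: ok'.
- by move=> t t' /andP [_ tq] /andP [_ tq'] /eqP; rewrite nth_uniq // => /eqP.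
- by move=> t t' /andP [_ tq] /andP [_ tq']; apply: adjq.
- apply: (@sub_in_pairwise _ (mem ws) _ _ _ _ _ pw); last exact/allP.
  move=> u w uw ww; rewrite -/(g u) -/(f w) => guf.
  (* If the spans were at consecutive positions, [u] and [w] would be at distance at most 3. *)
  rewrite ltn_neqAle guf andbT; apply/eqP => E.
  have := gnb u uw; have := fnb w ww; rewrite !nb'P => /and3P [_ fq wf] /and3P [_ gq ug].
  have Euw : u = w.
    apply: (nfar u w (1 + 1 + 1)); [exact: sub|exact: sub| |by rewrite /R; clear; lia].
    apply: (ball_trans (u := p (f w))); last by apply: ball_adj; rewrite adj_sym.
    apply: (ball_trans (u := p (g u))); apply: ball_adj => //.
    by rewrite -E adjq //; [rewrite /consec eqxx|rewrite E].
  have /andP [] := fg w _ ww (fnb w ww); rewrite -Euw in E *.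
  by move=> _; rewrite -E ltnn.
- move=> w ww; have := fnb w ww; have := gnb w ww.
  have /andP [_ H] := fg w _ ww (fnb w ww).
  by rewrite !nb'P c0 // => /and3P [-> -> ->] /and3P [_ _ ->].
- move=> w ww [|j] t jl /andP [_ tq] E; have /andP [pc pb] := pC t tq.
    by move: pb; rewrite -E c0 // Wb // sub.
  by move: pc; rewrite -E cpos.
- move=> w ww [|j] t jl /andP [okt tq].
    by rewrite c0 // => wt; split=> //; apply: fg => //; rewrite nb'P okt tq.
  move=> cp; have /andP [pc /negP []] := pC t tq.
  by apply: (mem_bnd _ cp pc); apply: cpos.
- move=> w w' ww ww' j j' jl jl' E.
  have Ew : w = w'.
    apply: (nfar w w' (j + j')); [exact: sub|exact: sub| |by rewrite /R; clear -jl jl'; lia].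
    by apply: ball_trans (cball w j ww jl) _; rewrite E ball_sym cball.
  split=> //; move: E; rewrite -Ew; have [_ _ _ H _] := Hc w (sub w ww); exact: H.
move=> w w' ww ww' j j' jl jl'; have [_ _ _ _ H] := Hc w (sub w ww).
case: eqVneq => [<-|nw]; first by rewrite H.
apply/negbTE; apply: contra nw => cc; apply/eqP.
apply: (nfar w w' (j + 1 + j')); [exact: sub|exact: sub| |by rewrite /R; clear -jl jl'; lia].
apply: (ball_trans (u := c w' j')); last by rewrite ball_sym cball.
by apply: ball_trans (cball w j ww jl) _; apply: ball_adj.
Qed.

Lemma fan_sub (G : sgraph) l ok p (ws : seq G) f g c (P : pred G) :
  fan l ok p ws f g c -> fan l ok p (filter P ws) f g c.
Proof.
move=> [[H1 H2 H3 H4] [H5 H6 H7 H8 H9]].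
have sub w : w \in filter P ws -> w \in ws by rewrite mem_filter => /andP [].
split; split => //.
- by rewrite pairwise_filter.
- by move=> w /sub; apply: H5.
- by move=> w /sub; apply: H6.
- by move=> w /sub; apply: H7.
- by move=> w w' /sub ww /sub; apply: H8.
- by move=> w w' /sub ww /sub; apply: H9.
Qed.

Lemma fan_nth (G : sgraph) l ok p ws f g c (w0 : G) n :
  @fan G l ok p ws f g c -> n <= size ws ->
  [/\ forall i, i < n -> nth w0 ws i \in ws,
      forall i j, i < j < n -> (g (nth w0 ws i)).+1 < f (nth w0 ws j)
    & forall i j, i < n -> j < n -> (nth w0 ws i == nth w0 ws j) = (i == j)].
Proof.
move=> [[_ _ _ pw] [fgP _ _ _ _]] nw.
have win i : i < n -> nth w0 ws i \in ws by move=> ni; rewrite mem_nth // (leq_trans ni).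
have lt i j : i < j < n -> (g (nth w0 ws i)).+1 < f (nth w0 ws j).
  move=> /andP [ij jn]; apply: (pairwiseP w0 pw) => //; apply: leq_trans nw => //.
  exact: ltn_trans jn.
have neq i j : i < j < n -> nth w0 ws i <> nth w0 ws j.
  move=> /[dup] /andP [ij jn] /lt + E; rewrite E.
  by have [h _ _ _] := fgP _ (win j jn); move=> h'; clear -h h'; lia.
split=> // i j ni nj; case: (ltngtP i j) => ij; last by rewrite ij eqxx.
  by apply/eqP/neq; rewrite ij.
by rewrite eq_sym; apply/eqP/neq; rewrite ij.
Qed.

(** When [w] has a single neighbour on the path (case [A]), that neighbour is the branch vertex and
    [c w] is its leg moved up by one. Otherwise [w] itself is the branch vertex on the rerouted
    path, and since its extreme neighbours are not consecutive they are not adjacent to each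
    other. *)
Lemma fan_claw (T G : sgraph) n (a d : T -> nat) l ok p ws f g c :
  0 < n -> comb_coords n a d -> (forall x, d x <= l) ->
  @fan G l ok p ws f g c -> n <= size ws ->
  {in ws, forall w, g w != (f w).+1} ->
  exists2 H, is_subdivision T H & contains_induced G H.
Proof.
move=> n0 co dl Hfan nw ntri.
have [w0 _] : exists w, w \in ws.
  by case: (ws) (leq_trans n0 nw) => // w ? _; exists w; rewrite mem_head.
have [win lt weq] := fan_nth w0 Hfan nw.
have [[okd pinj padj _] [fgP cp cadj cinj cc]] := Hfan.
pose w i := nth w0 ws i; pose F i := f (w i); pose E i := g (w i).
pose A i := F i == E i.
(* The path is left after position [e i] minus one and resumed at [s i]: on both sides of [F i] in
   case [A], and at the extreme neighbours [F i] and [E i] of [w i] otherwise. *)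
pose e i := if A i then F i else (F i).+1.
pose s i := if A i then (F i).+1 else E i.
pose leg i j := if A i then (if j is j'.+1 then c (w i) j' else p (F i)) else c (w i) j.
have FE i : i < n -> [/\ F i <= E i, E i <> (F i).+1, ok (F i), ok (E i) & w i \in ws].
  move=> ni; have wi := win i ni; have [h1 h2 _ _] := fgP _ wi.
  by split=> //; [apply/eqP/ntri|apply: okd h2].
have ltE i j : i < j < n -> (E i).+1 < F j by apply: lt.
have bnds i : i < n -> [/\ F i <= e i, e i < s i, e i <= (F i).+1 & s i <= (E i).+1].
  move=> /FE [h1 h2 _ _ _]; rewrite /e /s /A.
  by case: eqP => [h3|h3]; split; move: (F i) (E i) h1 h2 h3 => x y; clear; lia.
have se i j : i < j < n -> s i < e j.
  move=> /[dup] /andP [ij jn] /ltE h1.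
  have [h2 _ _ _] := bnds j jn; have [_ _ _ h3] := bnds i (ltn_trans ij jn).
  by clear -h1 h2 h3; lia.
have Fne i j : i < n -> j < n -> F i <= F j <= E i -> i = j.
  move=> ni nj; have [h1 _ _ _ _] := FE i ni; have [h2 _ _ _ _] := FE j nj.
  case: (ltngtP i j) => // ij; [have := ltE i j|have := ltE j i];
    rewrite ij ?ni ?nj => /(_ isT) h3 h4; clear -h1 h2 h3 h4; lia.
have legP i j : i < n -> j <= l ->
    [/\ A i, j = 0 & leg i j = p (F i)] \/
    exists j', [/\ j' <= l, leg i j = c (w i) j' & j = j' + A i].
  move=> ni jl; rewrite /leg; case Ai : (A i); last by right; exists j; rewrite addn0.
  case: j jl => [|j] jl; first by left.
  by right; exists j; rewrite addn1 (ltnW jl).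
(* Only path vertices that no rerouting skips and that are not branch vertices remain available. *)
pose ok2 t := ok t && all (fun i => (t < e i) || (s i <= t)) (iota 0 n).
have ok2P t i : ok2 t -> i < n -> (t < e i) || (s i <= t).
  by move=> /andP [_ /allP H] ni; apply: H; rewrite mem_iota.
have ok2W t : ok2 t -> ok t by case/andP.
apply: (@claw_embedding T G n a d l ok2 p e s leg) => //.
- by move=> t t' /ok2W ot /ok2W; apply: pinj.
- by move=> t t' /ok2W ot /ok2W; apply: padj.
- by move=> i /bnds [].
- move=> i t i1 /andP [st te]; apply/andP; split.
    have [h1 _ _ okE _] := FE i.+1 i1; have [_ _ h2 _] := bnds _ i1.
    by apply: okd okE; clear -te h1 h2; lia.
  apply/allP => k; rewrite mem_iota /= add0n => kn; have [_ h1 _ _] := bnds k kn.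
  case: (ltngtP k i) => [ki|ik|->]; last by rewrite st orbT.
    have := se k i; rewrite ki (ltnW i1) => /(_ isT) h2.
    by have [_ h3 _ _] := bnds i (ltnW i1); clear -h2 h3 st; lia.
  move: ik; rewrite leq_eqVlt => /predU1P [<-|ik]; first by rewrite te.
  have := se i.+1 k; rewrite ik kn => /(_ isT) h2.
  by have [_ h3 _ _] := bnds i.+1 i1; clear -h2 h3 te; lia.
- move=> i i' j j' ni ni' jl jl'.
  have [_ _ okF okE wi] := FE i ni; have [h1 _ okF' okE' wi'] := FE i' ni'.
  case: (legP i j ni jl) => [[Ai -> ->]|[k [kl -> Ej]]];
    case: (legP i' j' ni' jl') => [[Ai' -> ->]|[k' [kl' -> Ej']]].
  + move/pinj => /(_ okF okF') EF; split=> //; apply: Fne => //.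
    by rewrite -EF leqnn; have [] := FE i ni.
  + by move/esym/cp; case.
  + by move/cp; case.
  + move/cinj => /(_ wi wi' kl kl') [/eqP Ew Ek].
    by rewrite /w weq // in Ew; rewrite Ej Ej' Ek (eqP Ew).
- move=> i i' j j' ni ni' jl jl'.
  have [h1 _ okF okE wi] := FE i ni; have [h1' _ okF' okE' wi'] := FE i' ni'.
  have mix i1 i2 k : i1 < n -> i2 < n -> k <= l -> A i1 ->
      adj (c (w i2) k) (p (F i1)) = (i1 == i2) && consec 0 (k + A i2).
    move=> n1 n2 kl A1; have [_ _ okF1 _ _] := FE i1 n1; have [_ _ _ _ w2] := FE i2 n2.
    apply/idP/andP => [/cadj [] // k0 H|[/eqP E12 H]].
      have E12 : i2 = i1 by apply: Fne.
      by rewrite E12 A1 k0 eqxx.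
    have [_ _ H3 _] := fgP _ w2; rewrite -E12 A1 in H; rewrite E12.
    by case: k kl H => // k kl; rewrite /consec /= addn1.
  case: (legP i j ni jl) => [[Ai -> ->]|[k [kl -> Ej]]];
    case: (legP i' j' ni' jl') => [[Ai' -> ->]|[k' [kl' -> Ej']]].
  + rewrite padj //; case: eqVneq => [<-|nii]; rewrite /consec; first by clear; lia.
    apply/negbTE/negP; case: (ltngtP i i') nii => // ii _;
      [have := ltE i i'|have := ltE i' i]; rewrite ii ?ni ?ni' => /(_ isT) h2 h3;
      clear -h1 h1' h2 h3; lia.
  + by rewrite adj_sym mix // Ej'.
  + by rewrite mix // Ej eq_sym /consec orbC.
  + rewrite cc // /w weq // Ej Ej'; case: eqVneq => //= ->.
    by rewrite /consec; clear; lia.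
- move=> i j t ni jl /[dup] /ok2W okt /ok2P /(_ ni) ht.
  have [_ _ okF _ wi] := FE i ni.
  case: (legP i j ni jl) => [[Ai _ ->]|[k [kl -> _]]]; last exact: cp.
  move/pinj => /(_ okF okt) Et; move: ht; rewrite /e /s Ai -Et; clear; lia.
move=> i j t ni jl /[dup] /ok2W okt /ok2P /(_ ni) ht.
have [h1 h2 okF okE wi] := FE i ni.
case: (legP i j ni jl) => [[Ai -> ->]|[k [kl -> ->]]].
  by rewrite padj // /e /s Ai /consec /=; clear; lia.
move: ht; rewrite /e /s; case Ai : (A i) => ht.
  rewrite addn1 /=; apply/negbTE/negP => /cadj [] // k0; rewrite -/(F i) -/(E i) -(eqP Ai).
  by move: ht; clear; lia.
rewrite addn0; apply/idP/andP => [/cadj [] // -> |[/eqP -> /orP [/eqP [->]|/eqP ->]]].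
- by rewrite -/(F i) -/(E i) => h; split=> //; move: ht h; clear; lia.
- by have [] := fgP _ wi.
- by have [] := fgP _ wi.
Qed.

(** The path is kept whole. Here [c w 0] already stands for the lowest edge of the leg, so [c w]
    provides one edge more than the heights [d] call for. *)
Lemma fan_triangle (T G : sgraph) n (a d : T -> nat) l ok p ws f g c :
  0 < n -> comb_coords n a d -> (forall x, d x <= l) ->
  @fan G l ok p ws f g c -> n <= size ws ->
  {in ws, forall w, g w = (f w).+1} ->
  exists2 H, is_subdivision T H & contains_induced G (line_graph H).
Proof.
move=> n0 co dl Hfan nw tri.
have [w0 _] : exists w, w \in ws.
  by case: (ws) (leq_trans n0 nw) => // w ? _; exists w; rewrite mem_head.
have [win lt weq] := fan_nth w0 Hfan nw.
have [[okd pinj padj _] [fgP cp cadj cinj cc]] := Hfan.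
pose w i := nth w0 ws i.
apply: (@triangle_embedding T G n a d l ok p (fun i => f (w i)) (fun i => c (w i))) => //.
- by move=> x; apply: leqW.
- move=> i j ij; have := lt i j ij; rewrite tri; last by apply: win; case/andP: ij => /ltn_trans h /h.
  exact: ltn_trans.
- move=> t tf; have wi := win n.-1; rewrite ltn_predL in wi.
  have [h1 h2 _ _] := fgP _ (wi n0); apply: okd h2; exact: leq_trans tf h1.
- move=> i i' j j' ni ni' jl jl' /cinj [] //; rewrite ?win // => /eqP.
  by rewrite weq // => /eqP.
- by move=> i i' j j' ni ni' jl jl'; rewrite cc ?win // weq.
- by move=> i j t ni jl okt; apply: cp => //; apply: win.
move=> i j t ni jl okt; have wi := win i ni; have [h1 h2 h3 h4] := fgP _ wi.
rewrite tri // in h4; apply/idP/andP => [/cadj [] // -> |[/eqP -> /orP [] /eqP ->] //].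
by rewrite tri // => h; split=> //; move: h; rewrite /w; clear; lia.
Qed.

Theorem theorem1p11 (Delta : nat) (T : sgraph) :
  0 < Delta ->
  subcubic T ->
  subdivided_caterpillar T ->
  exists c : int,
    forall G : sgraph,
      max_degree G <= Delta ->
      (forall H : sgraph, is_subdivision T H -> ~ contains_induced G H) ->
      (forall H : sgraph, is_subdivision T H ->
         ~ contains_induced G (line_graph H)) ->
      (treewidth G <= c)%R.
Proof.
move=> _ cubic cat.
have [n [a [d [n0 co]]]] := caterpillar_coords cubic cat.
pose l := \max_(x : T) d x.
have dl x : d x <= l by apply: (bigmax_sup x).
(* Among [n + n] attachments, [n] are triangles or [n] are not. *)
have [s Hs] := fan_exists Delta l (n + n).
(* The successor provides the positive bound that [treewidth_path_state] asks for. *)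
exists ((s.+1 + Delta)%N%:Z)%R => G GD noT noL.
suff : (treewidth G <= (s.+1 + max_degree G)%N%:Z)%R by clear -GD; lia.
apply: treewidth_path_state => // v q C St; apply: leqW; rewrite leqNgt; apply/negP => bs.
have [ok [p [ws [f [g [c [sz Hfan]]]]]]] := Hs G GD v q C St bs.
pose P w := g w == (f w).+1.
have : (n <= size (filter P ws)) || (n <= size (filter (predC P) ws)).
  by move: sz; rewrite -(count_predC P ws) !size_filter; clear; lia.
case/orP => nP.
  have [|H HT] := fan_triangle n0 co dl (fan_sub P Hfan) nP; last exact: noL.
  by move=> w; rewrite mem_filter => /andP [/eqP].
have [|H HT] := fan_claw n0 co dl (fan_sub (predC P) Hfan) nP; last exact: noT.
by move=> w; rewrite mem_filter => /andP [].
Qed.
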